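(* Let $\Gamma$ be an infinite connected graph with finitely many ends. For any end-periodic homotopy equivalence $g\colon\Gamma\to\Gamma$, there exists a homotopy inverse $g'\colon\Gamma\to\Gamma$ for $g$ which is end-periodic and restricts to $g^{-1}$ on a neighborhood of each end of $\Gamma$.
   Context: **Graphs.** A graph is a locally finite $1$-dimensional CW complex; its $0$-cells are vertices and its open $1$-cells are edges. A subgraph is a closed subset that is a union of cells. A graph map is a continuous map between graphs sending vertices to vertices and edges to edge paths (finite concatenations of oriented edges; length $0$, i.e. constant at a vertex, is allowed). **Ends.** Let $\Gamma$ be an infinite graph. A sequence of nonempty nested subsets $U_1\supseteq U_2\supseteq\cdots$ is a neighborhood basis for an end if there is an exhaustion $K_1\subseteq K_2\subseteq\cdots$ of $\Gamma$ by compact sets such that each $U_n$ is a connected component of $\Gamma-K_n$. An end is an equivalence class of neighborhood bases, where $\{U_n\}\sim\{V_n\}$ if for each $n$ there are $i,j$ with $U_i\subseteq V_n$ and $V_j\subseteq U_n$. The set of ends is $\mathcal{E}(\Gamma)$. A neighborhood of an end $E$ is an open set $U$ that contains the tail of every neighborhood basis for $E$ but meets a neighborhood basis of any other end in only finitely many terms. **End-periodic maps.** A graph map $g\colon\Gamma\to\Gamma$ is end-periodic if there is a neighborhood $U_E$ of each end $E$ such that $g$ restricted to the largest subgraph contained in $\bigcup_{E\in\mathcal{E}(\Gamma)}U_E$ is a homeomorphism (onto its image) sending edges to edges, and, for some $p>0$, every $U_E$ satisfies one of: (i) $g^p(U_E)\subsetneq U_E$ and $\{g^{pn}(U_E)\}_{n\ge0}$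 is a neighborhood basis for $E$ (then $E$ is attracting); or (ii) $g^{-p}(U_E)\subsetneq U_E$ and $\{g^{-pn}(U_E)\}_{n\ge0}$ is a neighborhood basis for $E$ (then $E$ is repelling). On sufficiently small neighborhoods of the ends, $g$ has a well-defined inverse $g^{-1}$. *)

(* Defs.v *)
From HB Require Import structures.
From mathcomp Require Import all_boot all_order all_algebra.
From mathcomp Require Import all_classical all_reals all_analysis.

Set Implicit Arguments.
Unset Strict Implicit.
Unset Printing Implicit Defensive.

Import Order.TTheory GRing.Theory Num.Theory numFieldNormedType.Exports.

Local Open Scope classical_set_scope.
Local Open Scope ring_scope.

(* A locally finite 1-dimensional CW complex: a Hausdorff space together with
   its 0-cells and, for each 1-cell, a characteristic map, given as a map on R
   of which only the values on [0, 1] matter. *)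
Record graph (R : realType) := Graph {
  graph_space :> topologicalType;
  vertex : set graph_space;
  edge : Type;
  charmap : edge -> R -> graph_space;
  graph_hausdorff : hausdorff_space graph_space;
  charmap_continuous : forall e, {within `[0, 1], continuous (charmap e)};
  charmap_ends : forall e, vertex (charmap e 0) /\ vertex (charmap e 1);
  charmap_interior : forall e s, s \in `]0, 1[ -> ~ vertex (charmap e s);
  charmap_inj : forall e e' s s', s \in `]0, 1[ -> s' \in `]0, 1[ ->
    charmap e s = charmap e' s' -> e = e' /\ s = s';
  graph_cover : forall x, vertex x \/
    exists e, exists2 s, s \in `]0, 1[ & x = charmap e s;
  (* Weak topology. The 0-cells impose no condition, so every set of vertices
     is closed; the converse implication follows from continuity. *)
  graph_weak : forall A : set graph_space,
    (forall e, closed (`[0, 1] `&` charmap e @^-1` A)) -> closed A;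
  graph_locally_finite : forall x : graph_space, exists2 U, nbhs x U &
    finite_set (U `&` vertex) /\
    finite_set [set e | U `&` (charmap e @` `]0, 1[) !=set0]
}.

Section Graphs.
Context {R : realType}.
Implicit Type G : graph R.

(* The open 1-cell. *)
Definition cell G (e : edge G) : set G := charmap e @` `]0, 1[.

Definition graph_infinite G : Prop :=
  ~ (finite_set (@vertex R G) /\ finite_set [set: edge G]).

Definition subgraph G (A : set G) : Prop :=
  closed A /\ exists (V' : set G) (E' : set (edge G)),
    V' `<=` @vertex R G /\ A = V' `|` \bigcup_(e in E') cell e.

(* By local finiteness the union is itself a subgraph. *)
Definition largest_subgraph G (A : set G) : set G :=
  \bigcup_(H in [set H | subgraph H /\ H `<=` A]) H.

Definition oriented_edge G (e : edge G) (fwd : bool) (s : R) : G :=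
  charmap e (if fwd then s else 1 - s).

(* A path on [0, 1] that is constant at a vertex, or the concatenation of
   n.+1 oriented edges, each parametrized by an increasing homeomorphism phi
   from [t i, t i.+1] onto [0, 1]. *)
Definition edge_path G (gamma : R -> G) : Prop :=
  (exists2 v, @vertex R G v & forall s, s \in `[0, 1] -> gamma s = v) \/
  exists (n : nat) (t : nat -> R), [/\ t 0%N = 0, t n.+1 = 1 &
    forall i, (i <= n)%N -> t i < t i.+1 /\
      exists (e : edge G) (fwd : bool) (phi : R -> R),
        [/\ {within `[t i, t i.+1], continuous phi},
            {in `[t i, t i.+1] &, {homo phi : s s' / s < s'}},
            phi (t i) = 0, phi (t i.+1) = 1 &
            forall s, s \in `[t i, t i.+1] ->
              gamma s = oriented_edge e fwd (phi s)]].

Definition graph_map G1 G2 (g : G1 -> G2) : Prop :=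
  [/\ continuous g,
      g @` @vertex R G1 `<=` @vertex R G2 &
      forall e, edge_path (g \o charmap e)].

(* Covering by the interiors is what makes every compact set lie in some K n;
   covering by the K n alone would not, and would create spurious ends. *)
Definition exhaustion (T : topologicalType) (K : nat -> set T) : Prop :=
  [/\ forall n, compact (K n),
      forall n, K n `<=` K n.+1 &
      \bigcup_n (K n)° = [set: T]].

Definition is_component (T : topologicalType) (A U : set T) : Prop :=
  exists2 x, A x & U = connected_component A x.

Definition end_basis G (U : nat -> set G) : Prop :=
  (forall n, U n.+1 `<=` U n) /\
  exists2 K, exhaustion K & forall n, is_component (~` K n) (U n).

Definition end_equiv G (U V : nat -> set G) : Prop :=
  forall n, exists i j, U i `<=` V n /\ V j `<=` U n.

(* An end is an equivalence class, so E U reads: U is a neighborhood basis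
   for E. *)
Definition ends G : set (set (nat -> set G)) :=
  [set E | exists2 U, end_basis U &
    E = [set V | end_basis V /\ end_equiv U V]].

Definition end_nbhd G (E : set (nat -> set G)) (W : set G) : Prop :=
  [/\ open W,
      forall V, E V -> exists N, forall n, (N <= n)%N -> V n `<=` W &
      forall E', @ends G E' -> E' <> E -> forall V, E' V ->
        finite_set [set n | W `&` V n !=set0]].

Definition homeo_onto_image (S T : topologicalType) (A : set S)
    (f : S -> T) : Prop :=
  {within A, continuous f} /\
  exists2 h : T -> S, {within f @` A, continuous h} &
    forall x, A x -> h (f x) = x.

Definition attracting G (g : G -> G) (p : nat) (E : set (nat -> set G))
    (U : set G) : Prop :=
  iter p g @` U `<` U /\ E (fun n => iter (p * n) g @` U).

(* Negative powers of g applied to sets are preimages. *)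
Definition repelling G (g : G -> G) (p : nat) (E : set (nat -> set G))
    (U : set G) : Prop :=
  iter p g @^-1` U `<` U /\ E (fun n => iter (p * n) g @^-1` U).

Definition end_periodic G (g : G -> G) : Prop :=
  graph_map g /\
  exists U : set (nat -> set G) -> set G,
    let H := largest_subgraph (\bigcup_(E in @ends G) U E) in
    [/\ forall E, @ends G E -> end_nbhd E (U E),
        homeo_onto_image H g,
        forall e : edge G, cell e `<=` H ->
          exists e' : edge G, g @` cell e = cell e' &
        exists2 p, (0 < p)%N & forall E, @ends G E ->
          attracting g p E (U E) \/ repelling g p E (U E)].

Definition homotopic (S T : topologicalType) (f h : S -> T) : Prop :=
  exists F : S * R -> T,
    [/\ {within [set: S] `*` `[0, 1], continuous F},
        forall x, F (x, 0) = f x & forall x, F (x, 1) = h x].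

Definition homotopy_inverse (S T : topologicalType) (f : S -> T)
    (h : T -> S) : Prop :=
  [/\ continuous h, homotopic (h \o f) id & homotopic (f \o h) id].

Definition homotopy_equivalence (S T : topologicalType) (f : S -> T) : Prop :=
  continuous f /\ exists h, homotopy_inverse f h.

(* On W the map g has a well-defined inverse, and h agrees with it. *)
Definition restricts_to_inverse (T : Type) (W : set T) (g h : T -> T) : Prop :=
  forall x, W x -> g @^-1` [set x] = [set h x].

End Graphs.

(* Main.v *)
Require Import Defs.
From mathcomp Require Import all_boot all_order all_algebra.
From mathcomp Require Import all_classical all_reals all_analysis.
From mathcomp Require Import lra.

(** Near each end the map g is an isomorphism onto a neighborhood of some end,
    so it has an inverse k there; the question is whether k extends over the
    compact rest of the graph to a homotopy inverse of g that is a graph map.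

    Where k lives. The complement of any choice of neighborhoods of the ends is
    relatively compact (ends_cover, a version of Koenig's lemma), so g is an
    embedding off a compact set. It is also onto off a compact set. Near an
    attracting end this is part of the definition. Near a repelling end, the
    backward iterates of a neighborhood are nested and g maps each difference
    of consecutive ones to the previous difference, injectively and cell by
    cell; since the differences contain finitely many cells, only finitely many
    of these injections can fail to be onto (repelling_range). Hence there is a
    subgraph A with relatively compact complement over which g has exactly one
    preimage k a at each point a (inverse_domain).

    Extension. Let h be a homotopy inverse of g. On A the map h equals h g k,
    which is homotopic to k by the homotopy from h g to the identity. The
    homotopy extension property for the graph and its subgraph A then deforms h
    to a map equal to k on A, and cellular approximation relative to A makes it
    a graph map g' (cellular_extension, homotopy_inverse_extending). Both steps
    are carried out edge by edge: local finiteness allows homotopies to be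
    assembled from the closed squares edge x [0, 1] (homotopy_edgewise). For
    one edge, the extension step runs along the three other sides of the square
    (side_fillP), and the approximation step is the statement that a path
    between vertices is homotopic to an edge path relative to its endpoints
    (path_straighten). Being homotopic to h, the map g' is a homotopy inverse.

    Dynamics. Outside a compact set, images under g' are preimages under g, and
    preimages under g' are images under g. Therefore a neighborhood of an end,
    pushed far enough into the end by iterates of g or of its inverse, shows
    that attracting ends of g are repelling for g' and conversely
    (inverse_dynamics), with the same period p. *)

Set Implicit Arguments.
Unset Strict Implicit.
Unset Printing Implicit Defensive.
Import Order.TTheory GRing.Theory Num.Theory numFieldNormedType.Exports.
Local Open Scope classical_set_scope.
Local Open Scope ring_scope.

(** * Continuity on subsets, finiteness and compactness *)

Lemma within_continuous_nbhsP (S T : topologicalType) (A : set S) (f : S -> T) :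
  {within A, continuous f} <->
  (forall x, A x -> forall P, nbhs (f x) P ->
     \forall y \near x, A y -> P (f y)).
Proof.
split=> [/subspace_continuousP cf x Ax P /(cf x Ax)//|cf].
by apply/subspace_continuousP => x Ax P /(cf x Ax).
Qed.

Lemma within_continuous_comp (S T U : topologicalType) (A : set S) (B : set T)
    (f : S -> T) (h : T -> U) :
  {within A, continuous f} -> {within B, continuous h} ->
  (forall x, A x -> B (f x)) -> {within A, continuous (h \o f)}.
Proof.
move=> /within_continuous_nbhsP cf /within_continuous_nbhsP ch AB.
apply/within_continuous_nbhsP => x Ax P /(ch _ (AB _ Ax)) /(cf _ Ax).
by apply: filterS => y Py Ay; apply: Py => //; exact: AB.
Qed.

Lemma eq_within_continuous (S T : topologicalType) (A : set S) (f h : S -> T) :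
  (forall x, A x -> f x = h x) ->
  {within A, continuous f} -> {within A, continuous h}.
Proof.
move=> fh /within_continuous_nbhsP cf.
apply/within_continuous_nbhsP => x Ax P; rewrite -fh// => /(cf x Ax).
by apply: filterS => y Py Ay; rewrite -fh//; apply: Py.
Qed.

Lemma finite_set_ind (I : Type) (P : set I -> Prop) :
  P set0 -> (forall D i, P D -> P (i |` D)) ->
  forall D, finite_set D -> P D.
Proof.
move=> P0 PU D /finite_setP[n]; elim: n D => [|n IH] D.
  by rewrite II0 card_eq0 => /eqP ->.
move=> /eq_cardSP[x Dx cD].
have <- : x |` (D `\ x) = D by rewrite setUC setDKU// => y ->.
by apply: PU; apply: IH.
Qed.

Lemma near_finite (T I : Type) (F : set_system T) (D : set I)
    (P : I -> T -> Prop) : Filter F -> finite_set D ->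
  (forall i, D i -> F (P i)) -> F [set x | forall i, D i -> P i x].
Proof.
move=> FF fD; pattern D; apply: finite_set_ind fD => [_|{}D i IH DP].
  by apply: filterE => x i [].
have Di : (i |` D) i by left.
have PD : F [set x | forall j, D j -> P j x].
  by apply: IH => j Dj; apply: DP; right.
apply: filterS (filterI (DP _ Di) PD) => x [Pi PDx] j [-> //|]; exact: PDx.
Qed.

Lemma compact_bigcup (T : topologicalType) (I : Type) (D : set I)
    (F : I -> set T) : finite_set D ->
  (forall i, D i -> compact (F i)) -> compact (\bigcup_(i in D) F i).
Proof.
move=> fD; pattern D; apply: finite_set_ind fD => [_|{}D i IH FD].
  by rewrite bigcup_set0; apply: compact0.
rewrite bigcup_setU1; apply: compactU; first by apply: FD; left.
by apply: IH => j Dj; apply: FD; right.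
Qed.

(** Near-covering, for the filter of all sets of indices that contain a large
    enough finite set, turns local finiteness into finiteness on K. *)
Lemma compact_locally_finite (T : topologicalType) (I : Type) (K : set T)
    (S : T -> set I) :
  compact K ->
  (forall x : T, exists2 U, nbhs x U & finite_set (\bigcup_(y in U) S y)) ->
  finite_set (\bigcup_(y in K) S y).
Proof.
move=> /compact_near_coveringP nc lf.
pose F : set_system (set I) :=
  [set Q | exists2 D0, finite_set D0 & forall D, D0 `<=` D -> Q D].
have FF : Filter F.
  split.
  - by exists set0.
  - move=> P Q [D1 f1 P1] [D2 f2 Q2]; exists (D1 `|` D2).
      by rewrite finite_setU.
    by move=> D; rewrite subUset => -[? ?]; split; [apply: P1|apply: Q2].
  - by move=> P Q PQ [D fD PD]; exists D => // D' /PD /PQ.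
have [|D0 fD H] := nc _ F (fun D x => S x `<=` D) FF.
  move=> x _; have [U xU fU] := lf x.
  exists (U, [set D | \bigcup_(y in U) S y `<=` D]) => /=.
    by split=> //; exists (\bigcup_(y in U) S y).
  by move=> [y D] /= [Uy UD] i Si; apply: UD; exists y.
apply: sub_finite_set fD => i [y Ky]; exact: H.
Qed.

Definition in_compact (T : topologicalType) (A : set T) : Prop :=
  exists2 K, compact K & A `<=` K.

Lemma in_compactS (T : topologicalType) (A B : set T) :
  A `<=` B -> in_compact B -> in_compact A.
Proof. by move=> AB [K cK BK]; exists K => // x /AB /BK. Qed.

Lemma in_compactU (T : topologicalType) (A B : set T) :
  in_compact A -> in_compact B -> in_compact (A `|` B).
Proof.
by move=> [K cK AK] [L cL BL]; exists (K `|` L); [apply: compactU|apply: setUSS].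
Qed.

Lemma in_compact_bigcup (T : topologicalType) (I : Type) (D : set I)
    (F : I -> set T) : finite_set D ->
  (forall i, D i -> in_compact (F i)) -> in_compact (\bigcup_(i in D) F i).
Proof.
move=> fD; pattern D; apply: finite_set_ind fD => [_|{}D i IH FD].
  by exists set0; [apply: compact0|rewrite bigcup_set0].
rewrite bigcup_setU1; apply: in_compactU; first by apply: FD; left.
by apply: IH => j Dj; apply: FD; right.
Qed.

(** * The topology of a graph *)

Section GraphTopology.
Context {R : realType} {G : graph R}.
Implicit Types (e : edge G) (x : G) (s : R).

Definition closed_edge e : set G := charmap e @` `[0, 1].

Lemma unit_itvE (s : R) :
  s \in `[0, 1] -> [\/ s = 0, s = 1 | s \in `]0, 1[].
Proof.
rewrite !in_itv /= => /andP[]; rewrite le_eqVlt => /orP[/eqP <-|s0].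
  by constructor 1.
rewrite le_eqVlt => /orP[/eqP ->|s1]; first by constructor 2.
by constructor 3; rewrite s0 s1.
Qed.

Lemma open_unitW (s : R) : s \in `]0, 1[ -> s \in `[0, 1].
Proof. exact: subset_itv_oo_cc. Qed.

Lemma unit0 : (0 : R) \in `[0, 1]. Proof. by rewrite in_itv /= lexx ler01. Qed.
Lemma unit1 : (1 : R) \in `[0, 1]. Proof. by rewrite in_itv /= lexx ler01. Qed.

Lemma unit_half : (1 / 2 : R) \in `]0, 1[.
Proof. by rewrite in_itv /=; lra. Qed.

Lemma vertex_charmap e s :
  s \in `[0, 1] -> vertex (charmap e s) -> s = 0 \/ s = 1.
Proof.
move=> /unit_itvE[->|->|s01 v]; [by left|by right|].
by have := @charmap_interior R G e s s01.
Qed.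

Lemma cell_midpoint e : cell e (charmap e (1 / 2)).
Proof. by exists (1 / 2) => //; apply: unit_half. Qed.

Lemma cell_not_vertex e x : cell e x -> ~ vertex x.
Proof. by move=> [s s01 <-]; apply: charmap_interior. Qed.

Lemma cell_closed_edge e : cell e `<=` closed_edge e.
Proof. by move=> _ [s /open_unitW s01 <-]; exists s. Qed.

Lemma cell_inj e e' x : cell e x -> cell e' x -> e = e'.
Proof. by move=> [s s01 <-] [s' s01' /esym/charmap_inj[]]. Qed.

Lemma closed_edgeP e x : closed_edge e x ->
  cell e x \/ vertex x /\ (x = charmap e 0 \/ x = charmap e 1).
Proof.
have [v0 v1] := @charmap_ends R G e.
move=> [s /unit_itvE[->|->|s01] <-]; [right|right|left].
- by split=> //; left.
- by split=> //; right.
- by exists s.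
Qed.

Lemma compact_closed_edge e : compact (closed_edge e).
Proof.
apply: continuous_compact; last exact: segment_compact.
exact: charmap_continuous.
Qed.

Lemma connected_cell e : connected (cell e).
Proof.
apply: connected_continuous_connected.
  by rewrite connected_intervalP; apply: interval_is_interval.
apply: continuous_subspaceW (@charmap_continuous R G e).
by move=> s; apply: open_unitW.
Qed.

Lemma connected_closed_edge e : connected (closed_edge e).
Proof.
apply: connected_continuous_connected (@charmap_continuous R G e).
by rewrite connected_intervalP; apply: interval_is_interval.
Qed.

(** The trace on an edge is either everything or a set of at most two points,
    hence closed, so the weak topology imposes nothing at the vertices. *)
Lemma closed_edgewise (A : set G) :
  (forall e, closed_edge e `<=` A \/ cell e `&` A = set0) -> closed A.
Proof.
move=> HA; apply: graph_weak => e; have [eA|eA] := HA e.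
  rewrite (_ : _ `&` _ = [set` `[0, 1]]); first exact: interval_closed.
  by apply/seteqP; split=> [s []//|s s01]; split=> //; apply: eA; exists s.
apply: (accessible_finite_set_closed.1 (hausdorff_accessible _)).
  exact: Rhausdorff.
apply: (@sub_finite_set _ _ [set 0; 1]); last exact: finite_set2.
move=> s [/unit_itvE[->|->|s01] As]; [by left|by right|].
suff : set0 (charmap e s) by [].
by rewrite -eA; split => //; exists s.
Qed.

(** No other edge meets this set, and the ends of the edge e itself are not in
    it, so the weak topology has to be tested on e alone. *)
Lemma open_charmap_image e (J : set R) :
  open J -> open (charmap e @` (`]0, 1[ `&` J)).
Proof.
move=> oJ; rewrite -[X in open X]setCK openC; apply: graph_weak => e'.
have [<-|ee'] := pselect (e = e').
  rewrite (_ : _ `&` _ = `[0, 1] `&` ~` (`]0, 1[ `&` J)).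
    apply: closedI; first exact: interval_closed.
    by apply: open_closedC; apply: openI => //; apply: interval_open.
  apply/seteqP; split => s [s01 H]; split => //.
    by move=> Js; apply: H; exists s.
  move=> [s' [s01' Js'] ss']; apply: H.
  have s01o : s \in `]0, 1[.
    have [s0|s1|//] := unit_itvE s01; have := @charmap_interior R G e _ s01';
      rewrite ss' ?s0 ?s1; have [] := @charmap_ends R G e; tauto.
  by have [_ <-] := charmap_inj s01' s01o ss'; split.
rewrite (_ : _ `&` _ = [set` `[0, 1]]); first exact: interval_closed.
apply/seteqP; split => [s []//|s s01]; split => // -[s' [s01' _] ss'].
have [s0|s1|s01o] := unit_itvE s01.
- have := @charmap_interior R G e _ s01'; rewrite ss' s0.
  by have [] := @charmap_ends R G e'; tauto.
- have := @charmap_interior R G e _ s01'; rewrite ss' s1.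
  by have [] := @charmap_ends R G e'; tauto.
- by have [/ee'] := charmap_inj s01' s01o ss'.
Qed.

Lemma open_cell e : open (cell e).
Proof.
have := @open_charmap_image e _ openT; by rewrite setIT.
Qed.

(** The characteristic map is open on the interior of the edge, which makes
    its inverse continuous there. *)
Lemma cell_coordinate e : exists c : G -> R,
  (forall s, s \in `]0, 1[ -> c (charmap e s) = s) /\
  {within cell e, continuous c}.
Proof.
have /choice[c cP] : forall x, exists s, cell e x ->
    (s \in `]0, 1[) /\ x = charmap e s.
  move=> x; have [[s s01 <-]|nx] := pselect (cell e x); last by exists 0.
  by exists s.
have cK s : s \in `]0, 1[ -> c (charmap e s) = s.
  move=> s01; have [|c01 /charmap_inj[]//] := cP (charmap e s).
  by exists s.
exists c; split=> //; apply/within_continuous_nbhsP => x ex J.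
rewrite nbhsE => -[J' [oJ' J'x] J'J].
have [c01 xc] := cP _ ex.
suff : nbhs x (charmap e @` (`]0, 1[ `&` J')).
  by apply: filterS => _ [s [s01 Js] <-] _; rewrite cK//; apply: J'J.
apply: open_nbhs_nbhs; split; first exact: open_charmap_image.
by rewrite xc; exists (c x).
Qed.

Lemma near_open_unit (s d : R) : s \in `[0, 1] -> 0 < d ->
  exists2 s', s' \in `]0, 1[ & ball s d s'.
Proof.
rewrite in_itv /= => /andP[s0 s1] d0; have [sh|sh] := leP s (1 / 2).
  exists (s + Num.min (d / 2) (1 / 4)).
    by rewrite in_itv /=; apply/andP; split; case: (leP (d / 2)) => ?; lra.
  rewrite /ball /= opprD addrA subrr sub0r normrN ger0_norm; last first.
    by case: (leP (d / 2)) => ?; lra.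
  by case: (leP (d / 2)) => ?; lra.
exists (s - Num.min (d / 2) (1 / 4)).
  by rewrite in_itv /=; apply/andP; split; case: (leP (d / 2)) => ?; lra.
rewrite /ball /= opprB addrCA subrr addr0 ger0_norm; last first.
  by case: (leP (d / 2)) => ?; lra.
by case: (leP (d / 2)) => ?; lra.
Qed.

Lemma closed_edge_closure e : closed_edge e `<=` closure (cell e).
Proof.
move=> _ [s s01 <-] U Uy.
have /within_continuous_nbhsP/(_ s s01 U Uy) := @charmap_continuous R G e.
move=> /nbhs_ballP[d /= d0 sd]; have [s' s'01 s's] := near_open_unit s01 d0.
exists (charmap e s'); split; first by exists s'.
by apply: sd => //; apply: open_unitW.
Qed.

(** An open set that meets a closed edge meets its interior, so local
    finiteness of the open cells passes to the closed ones. *)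
Lemma locally_finite_closed_edges x :
  exists2 U, nbhs x U &
    finite_set [set e | U `&` closed_edge e !=set0].
Proof.
have [U xU [_ fU]] := @graph_locally_finite R G x.
exists U°; first exact: nbhs_interior.
apply: sub_finite_set fU => e [y [Uy /closed_edge_closure/(_ _ Uy)]].
by move=> [z [ez Uz]]; exists z.
Qed.

Lemma compact_meets_finite (K : set G) :
  compact K -> finite_set [set e | K `&` closed_edge e !=set0].
Proof.
move=> cK; pose S x := [set e | closed_edge e x].
apply: (@sub_finite_set _ _ (\bigcup_(x in K) S x)).
  by move=> e [x [Kx ex]]; exists x.
apply: compact_locally_finite => // x.
have [U xU fU] := locally_finite_closed_edges x; exists U => //.
by apply: sub_finite_set fU => e [y Uy ey]; exists y.
Qed.

(** Graphs are locally connected: along each edge, a point of O has a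
    neighborhood interval whose image stays in O. *)
Lemma open_component (O : set G) x : open O -> open (connected_component O x).
Proof.
move=> oO; rewrite -[X in open X]setCK openC; apply: graph_weak => e s clos.
have s01 : s \in `[0, 1].
  have : closed (`[0, 1] : set R) by apply: interval_closed.
  by apply => B /clos[s' [[? ?] ?]]; exists s'.
split => // Cs.
have Os : nbhs (charmap e s) O.
  by apply: open_nbhs_nbhs; split => //; apply: connected_component_sub Cs.
have /within_continuous_nbhsP/(_ s s01 O Os) := @charmap_continuous R G e.
move=> /nbhs_ballP[d /= d0 sd].
have [s' [[s'01 nC] s's]] := clos _ (nbhsx_ballx s d d0).
apply: nC; apply: (connected_component_trans Cs).
pose J := (`[0, 1] : set R) `&` ball s d.
apply: (@connected_component_max _ _ (charmap e @` J)).
- by exists s => //; split => //; apply: ballxx.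
- by move=> _ [u [u01 us] <-]; apply: sd.
- apply: connected_continuous_connected; last first.
    by apply: continuous_subspaceW (@charmap_continuous R G e) => u [].
  apply/connected_intervalP => u v [u01 us] [v01 vs] w /andP[uw wv].
  move: u01 v01 us vs; rewrite /J /= !in_itv /= /ball /= => /andP[? ?] /andP[? ?].
  rewrite !ltr_distlC => /andP[? ?] /andP[? ?].
  by split; apply/andP; split; lra.
- by exists s'.
Qed.

End GraphTopology.

(** * Subgraphs and stars *)

Section Stars.
Context {R : realType} {G : graph R}.
Implicit Types (e : edge G) (x : G) (A K : set G).

(** Being a subgraph, without exhibiting the cells: unions of vertices and
    closed edges are exactly the saturated sets. *)
Definition saturated A : Prop :=
  forall e x, cell e x -> A x -> closed_edge e `<=` A.

Lemma saturated_closed A : saturated A -> closed A.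
Proof.
move=> sA; apply: closed_edgewise => e.
have [[x [ex Ax]]|ne] := pselect (cell e `&` A !=set0).
  by left; apply: sA Ax.
by right; apply/eqP; apply: contrapT => /negP/set0P.
Qed.

Lemma saturated_closed_edge e : saturated (closed_edge e).
Proof.
move=> e' x e'x /closed_edgeP[ex|[vx _]]; first by rewrite (cell_inj e'x ex).
by have := cell_not_vertex e'x vx.
Qed.

Lemma saturated_largest_subgraph A : saturated (largest_subgraph A).
Proof.
move=> e x ex [B [sB BA]] Bx y ey; exists B => //.
have [cB [V [E [VV BE]]]] := sB.
have eB : cell e `<=` B.
  move: Bx; rewrite BE => -[/VV vx|[e' Ee' e'x] z ez].
    by have := cell_not_vertex ex vx.
  by right; exists e' => //; rewrite -(cell_inj ex e'x).
apply: cB; apply: closure_subset eB _ _; exact: closed_edge_closure ey.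
Qed.

Lemma sub_largest_subgraph A B :
  saturated A -> A `<=` B -> A `<=` largest_subgraph B.
Proof.
move=> sA AB x Ax; exists A => //; split => //; split.
  exact: saturated_closed.
exists (A `&` vertex (g := G)), [set e | cell e `<=` A]; split.
  by move=> y [].
apply/seteqP; split => y; last by move=> [[]|[e eA /eA]].
move=> Ay; have [vy|[e [s s01 ys]]] := graph_cover y; first by left.
have ey : cell e y by exists s.
by right; exists e => // z /cell_closed_edge; apply: sA Ay _.
Qed.

Lemma largest_subgraph_sub A : largest_subgraph A `<=` A.
Proof. by move=> x [B [_ BA] /BA]. Qed.

Definition star K : set G :=
  K `|` \bigcup_(e in [set e | K `&` closed_edge e !=set0]) closed_edge e.

Lemma sub_star K : K `<=` star K. Proof. by move=> x; left. Qed.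

Lemma compact_star K : compact K -> compact (star K).
Proof.
move=> cK; apply: compactU => //; apply: compact_bigcup.
  exact: compact_meets_finite.
by move=> e _; apply: compact_closed_edge.
Qed.

Lemma saturated_star K : saturated (star K).
Proof.
move=> e x ex [Kx|[e' Ke' /(saturated_closed_edge ex) ee']]; last first.
  by move=> y /ee' ?; right; exists e'.
by move=> y ey; right; exists e => //; exists x; split => //; apply: cell_closed_edge.
Qed.

(** K together with the open edges adjacent to it is open. *)
Lemma star_interior K : K `<=` (star K)°.
Proof.
set O := K `|` \bigcup_(e in [set e | K `&` closed_edge e !=set0]) cell e.
have oO : open O.
  rewrite -[X in open X]setCK openC; apply: closed_edgewise => e.
  have [Ke|nKe] := pselect (K `&` closed_edge e !=set0); [right|left].
    by apply/seteqP; split => // x [ex]; apply; right; exists e.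
  move=> x ex [Kx|[e' [z [Kz zK]] e'x]]; apply: nKe; first by exists x.
  exists z; split => //.
  exact: saturated_closed_edge e'x ex _ zK.
have OS : O `<=` star K.
  move=> y [Ky|[e Ke ey]]; first by left.
  by right; exists e => //; apply: cell_closed_edge.
by move=> x Kx; apply: filterS OS _; apply: open_nbhs_nbhs; split => //; left.
Qed.

(** Besides a compact set that contains the complement of A, the largest
    subgraph misses only the finitely many edges adjacent to that set. *)
Lemma in_compact_largest_subgraph A :
  in_compact (~` A) -> in_compact (~` largest_subgraph A).
Proof.
move=> [K cK AK]; exists (star K); first exact: compact_star.
pose B := [set x | ~ K x /\ forall e, cell e x -> ~ (K `&` closed_edge e !=set0)].
have BA : B `<=` largest_subgraph A.
  apply: sub_largest_subgraph => [e x ex [_ /(_ e ex) Ke] y ey|x [nK _]].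
    split=> [Ky|e' e'y]; first by apply: Ke; exists y.
    move=> Ke'; apply: Ke.
    have [z [Kz ze']] := Ke'; exists z; split => //.
    exact: saturated_closed_edge e'y ey _ ze'.
  by apply: contrapT => /AK.
move=> x nx; have [Kx|nKx] := pselect (K x); first by left.
apply: contrapT => nsx; apply: nx; apply: BA; split => // e ex Ke; apply: nsx.
by right; exists e => //; apply: cell_closed_edge.
Qed.

End Stars.

(** * Ends *)

Lemma nested_le (T : Type) (L : nat -> set T) :
  (forall n, L n `<=` L n.+1) -> forall m n, (m <= n)%N -> L m `<=` L n.
Proof. by apply: homo_leq => [A x//|B A C AB BC x /AB /BC]. Qed.

Lemma exhaustion_absorbs (T : topologicalType) (L : nat -> set T) (K : set T) :
  exhaustion L -> compact K -> exists N, forall n, (N <= n)%N -> K `<=` L n.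
Proof.
move=> [_ nL cL] /compact_near_coveringP nc.
have LL := nested_le nL.
have [|N _ NP] := nc _ \oo (fun n x => L n x) _.
  move=> x _; have [n _ Lx] : (\bigcup_n (L n)°) x by rewrite cL.
  exists ((L n)°, [set m | (n <= m)%N]) => /=.
    by split; [exact: nbhs_interior|exists n].
  by move=> [y m] /= [Ly nm]; apply: (LL _ _ nm); apply: interior_subset.
by exists N => n /NP.
Qed.

Section EndBases.
Context {R : realType} {G : graph R}.
Implicit Types (V : nat -> set G) (E : set (nat -> set G)).

Lemma end_basis_le V : end_basis V ->
  forall m n, (m <= n)%N -> V n `<=` V m.
Proof.
move=> [dV _]; apply: (@homo_leq _ V (fun A B => B `<=` A)) => [A x//||//].
by move=> B A C AB BC x /BC /AB.
Qed.

Lemma end_basis_nonempty V n : end_basis V -> V n !=set0.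
Proof.
move=> [_ [K _ /(_ n) [x nKx ->]]]; exists x; exact: connected_component_refl.
Qed.

Lemma end_basis_open V n : end_basis V -> open (V n).
Proof.
move=> [_ [K [cK _ _] /(_ n) [x nKx ->]]]; apply: open_component.
by apply: closed_openC; apply: compact_closed => //; apply: graph_hausdorff.
Qed.

Lemma end_basis_avoids V (K : set G) : end_basis V -> compact K ->
  exists N, forall n, (N <= n)%N -> V n `&` K = set0.
Proof.
move=> [_ [L exL VL]] cK; have [N NP] := exhaustion_absorbs exL cK.
exists N => n /NP KL; apply/seteqP; split => // x [Vx Kx].
have [z _ Vn] := VL n; move: Vx; rewrite Vn => /connected_component_sub; apply.
exact: KL.
Qed.

Lemma end_equiv_refl V : end_equiv V V.
Proof. by move=> n; exists n, n; split. Qed.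

Lemma end_basisW E V : ends E -> E V -> end_basis V.
Proof. by move=> [U bU ->] []. Qed.

Lemma end_equivE E V V' : ends E -> E V -> E V' -> end_equiv V V'.
Proof.
move=> [U bU ->] [bV UV] [bV' UV'] n.
have [i [j [UiV' _]]] := UV' n; have [i' [j' [_ ViU]]] := UV i.
have [k [l [UkV _]]] := UV n; have [k' [l' [_ V'lU]]] := UV' k.
by exists j', l'; split => x; [move=> /ViU /UiV'|move=> /V'lU /UkV].
Qed.

Lemma end_shift E V m : ends E -> E V -> E (fun n => V (m + n)%N).
Proof.
move=> [U bU ->] [bV UV]; have [dV [K [cK nK uK] VK]] := bV.
have KK := nested_le nK.
split.
  split=> [n|]; first by rewrite addnS; apply: dV.
  exists (fun n => K (m + n)%N) => //; split => //.
    by move=> n; rewrite addnS; apply: nK.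
  apply/seteqP; split => // x _; have : (\bigcup_n (K n)°) x by rewrite uK.
  move=> [n _ Kx]; exists n => //; apply: interiorS Kx; apply: KK.
  exact: leq_addl.
move=> n; have [i [j [UV1 _]]] := UV (m + n)%N; have [i' [j' [_ VU]]] := UV n.
exists i, j'; split => // x /(end_basis_le bV (leq_addl m j')); exact: VU.
Qed.

Lemma end_nbhd_basis E V W n : ends E -> E V -> end_nbhd E W -> V n `<=` W ->
  end_nbhd E (V n).
Proof.
move=> eE EV [oW tW fW] VW; have bV := end_basisW eE EV; split.
- exact: end_basis_open.
- move=> V' EV'; have [i [j [_ V'V]]] := end_equivE eE EV EV' n.
  exists j => k /(end_basis_le (end_basisW eE EV')) H x /H; exact: V'V.
- move=> E' eE' ne V' EV'; apply: sub_finite_set (fW _ eE' ne _ EV').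
  by move=> k [x [Vx V'x]]; exists x; split => //; apply: VW.
Qed.

End EndBases.

Section Koenig.
Context {R : realType} {G : graph R}.
Context (G_infinite : graph_infinite G) (G_connected : connected [set: G]).
Implicit Types (e : edge G) (x : G) (A K Y : set G).

Lemma clopen_setT A : open A -> closed A -> A !=set0 -> A = setT.
Proof.
by move=> oA cA A0; apply: (G_connected A0); exists A => //; rewrite setTI.
Qed.

(** An isolated vertex would be the whole graph. *)
Lemma on_closed_edge x : exists e, closed_edge e x.
Proof.
have [vx|[e [s s01 ->]]] := graph_cover x; last first.
  by exists e; apply: cell_closed_edge; exists s.
apply: contrapT => ne.
have xT : [set x] = setT.
  apply: clopen_setT; last by exists x.
    rewrite -[X in open X]setCK openC; apply: closed_edgewise => e; left.
    by move=> y ey /= yx; apply: ne; exists e; rewrite -yx.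
  apply: (accessible_finite_set_closed.1 (hausdorff_accessible _)).
    exact: graph_hausdorff.
  exact: finite_set1.
apply: G_infinite; split.
  by apply: (@sub_finite_set _ _ [set x]); rewrite ?xT//; rewrite -xT; apply: finite_set1.
rewrite (_ : [set: edge G] = set0) //; apply/seteqP; split => // e _; apply: ne.
exists e; have : [set: G] (charmap e (1 / 2)) by [].
by rewrite -xT => /= <-; apply/cell_closed_edge/cell_midpoint.
Qed.

Lemma graph_nonempty : exists x : G, True.
Proof.
apply: contrapT => ne; apply: G_infinite; split.
  rewrite (_ : @vertex R G = set0); first exact: finite_set0.
  by apply/seteqP; split => // x _; apply: ne; exists x.
rewrite (_ : [set: edge G] = set0); first exact: finite_set0.
by apply/seteqP; split => // e _; apply: ne; exists (charmap e 0).
Qed.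

(** The union of the iterated stars is open by star_interior; it is closed
    because an edge that meets one of them lies in the next. *)
Lemma exhaustion_star K : compact K -> K !=set0 ->
  exhaustion (fun n => iter n star K).
Proof.
move=> cK [x0 Kx0]; set L := fun n => _.
have LS n : L n `<=` (L n.+1)° by apply: star_interior.
split => [n|n x /LS/interior_subset//|].
  by elim: n => // n; apply: compact_star.
apply: clopen_setT.
- by apply: bigcup_open => n _; apply: open_interior.
- apply: closed_edgewise => e.
  have [[x [ex [n _ Lx]]]|ne] :=
      pselect (closed_edge e `&` \bigcup_n (L n)° !=set0).
    left=> y ey; exists n.+2 => //; apply: (LS n.+1); right; exists e => //.
    by exists x; split => //; apply: interior_subset.
  right; apply/seteqP; split => // x [/cell_closed_edge ex Lx].
  by apply: ne; exists x.
- by exists x0, 1%N => //; apply: (LS 0%N).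
Qed.

(** Connectedness of the graph forces every component of the complement of K
    to contain the interior of one of the finitely many edges adjacent to K,
    so if Y had only relatively compact traces on the components it would be
    relatively compact. *)
Lemma component_not_in_compact K Y : compact K -> saturated K -> K !=set0 ->
  ~ in_compact Y ->
  exists2 x, ~ K x & ~ in_compact (Y `&` connected_component (~` K) x).
Proof.
move=> cK sK [k Kk] nY; apply: contrapT => H; apply: nY.
have {}H x : ~ K x -> in_compact (Y `&` connected_component (~` K) x).
  by move=> nKx; apply: contrapT => ?; apply: H; exists x.
pose D := [set e | K `&` closed_edge e !=set0].
pose C e := connected_component (~` K) (charmap e (1 / 2)).
have YC : Y `<=` K `|` \bigcup_(e in D) (Y `&` C e); last first.
  apply: in_compactS YC _; apply: in_compactU; first by exists K.
  apply: in_compact_bigcup; first exact: compact_meets_finite.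
  move=> e _; have [Ke|nKe] := pselect (K (charmap e (1 / 2))); last exact: H.
  rewrite /C connected_component_out; last by apply.
  by rewrite setI0; exists set0 => //; apply: compact0.
move=> y Yy; have [Ky|nKy] := pselect (K y); [by left|right].
apply: contrapT => nC.
pose U := connected_component (~` K) y.
have Uy : U y by apply: connected_component_refl.
have oK : open (~` K).
  by apply: closed_openC; apply: saturated_closed.
suff UT : U = setT.
  have : U k by rewrite UT.
  by move=> /connected_component_sub.
apply: clopen_setT; [exact: open_component| |by exists y].
apply: closed_edgewise => e.
have [De|nDe] := pselect (D e).
  right; apply/seteqP; split => // x [ex Ux]; apply: nC; exists e => //.
  split => //; rewrite /C; apply: connected_component_sym.
  apply: (connected_component_trans Ux).
  apply: (@connected_component_max _ _ (cell e)) => //.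
  - move=> z ez Kz; have := connected_component_sub Ux; apply.
    by apply: (sK e z) => //; apply: cell_closed_edge.
  - exact: connected_cell.
  - exact: cell_midpoint.
have [[x [ex Ux]]|nU] := pselect (closed_edge e `&` U !=set0).
  left=> z ez; apply: (connected_component_trans Ux).
  apply: (@connected_component_max _ _ (closed_edge e)) => //.
  - by move=> w ew Kw; apply: nDe; exists w.
  - exact: connected_closed_edge.
right; apply/seteqP; split => // x [/cell_closed_edge ex Ux].
by apply: nU; exists x.
Qed.

(** If the rest were not relatively compact, following pieces of it that are
    not through the components of an exhaustion would produce an end, as in
    Koenig's lemma, and every neighborhood of that end would meet the rest. *)
Lemma ends_cover (W : set (nat -> set G) -> set G) :
  (forall E, ends E -> end_nbhd E (W E)) ->
  in_compact (~` \bigcup_(E in @ends R G) W E).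
Proof.
move=> HW; apply: contrapT; set Y := ~` _ => nY.
have [x0 _] := graph_nonempty; have [e0 e0x] := on_closed_edge x0.
pose K := closed_edge e0; pose L n := iter n star K.
have exL : exhaustion L.
  by apply: exhaustion_star; [exact: compact_closed_edge|exists x0].
have L0 n : L n !=set0.
  by exists x0; elim: n => // n IH; apply: sub_star.
have sL n : saturated (L n).
  case: n => [|n]; [exact: saturated_closed_edge|exact: saturated_star].
have [cL nL _] := exL.
pose Q n (U : set G) := is_component (~` L n) U /\ ~ in_compact (Y `&` U).
have step n (U : set G) : exists U', Q n U -> Q n.+1 U' /\ U' `<=` U.
  have [[[x nx ->] nU]|nQ] := pselect (Q n U); last by exists set0.
  have [x' nx' nY'] := component_not_in_compact (cL n.+1) (sL n.+1) (L0 n.+1) nU.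
  exists (connected_component (~` L n.+1) x') => _; split.
    split; first by exists x'.
    by apply: contra_not nY'; apply: in_compactS => z [[? _] ?].
  have [z [[Yz xz] x'z]] : (Y `&` connected_component (~` L n) x)
      `&` connected_component (~` L n.+1) x' !=set0.
    apply: contrapT => ne; apply: nY'; exists set0; first exact: compact0.
    by move=> z ?; apply: ne; exists z.
  move=> w x'w; apply: (connected_component_trans xz).
  apply: (@connected_component_max _ _ (connected_component (~` L n.+1) x')) => //.
  - by move=> v /connected_component_sub nv Lv; apply: nv; apply: nL.
  - exact: component_connected.
have [U0 Q0] : exists U, Q 0%N U.
  have [x nx nx'] := component_not_in_compact (cL 0%N) (sL 0%N) (L0 0%N) nY.
  by exists (connected_component (~` L 0%N) x); split => //; exists x.
have /choice[f fP] : forall nU : nat * set G, exists U',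
    Q nU.1 nU.2 -> Q nU.1.+1 U' /\ U' `<=` nU.2 by case.
pose U := fix U n := if n is m.+1 then f (m, U m) else U0.
have QU n : Q n (U n) by elim: n => //= n IH; have [] := fP (n, U n) IH.
have bU : end_basis U.
  split=> [n|]; first by have [] := fP (n, U n) (QU n).
  by exists L => // n; have [] := QU n.
pose E := [set V | end_basis V /\ end_equiv U V].
have eE : ends E by exists U.
have EU : E U by split => //; apply: end_equiv_refl.
have [_ /(_ U EU) [N /(_ N (leqnn N)) UW] _] := HW _ eE.
have [_] := QU N; apply; exists set0; first exact: compact0.
by move=> x [nx /UW Wx]; apply: nx; exists E.
Qed.

End Koenig.

(** * Homotopies *)

Lemma within_continuousW (S T : topologicalType) (A : set S) (f : S -> T) :
  continuous f -> {within A, continuous f}.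
Proof. exact: continuous_subspaceT. Qed.

Lemma within_continuous_pair (S T U : topologicalType) (A : set S)
    (f : S -> T) (h : S -> U) :
  {within A, continuous f} -> {within A, continuous h} ->
  {within A, continuous (fun x => (f x, h x))}.
Proof.
move=> /within_continuous_nbhsP cf /within_continuous_nbhsP ch.
apply/within_continuous_nbhsP => x Ax P [[B C] /= [Bf Ch] BCP].
near=> y => Ay; apply: BCP; split=> /=.
- by move: Ay; near: y; apply: cf.
- by move: Ay; near: y; apply: ch.
Unshelve. all: by end_near. Qed.

Section RealContinuity.
Context {R : realType} {S : topologicalType} {A : set S}.
Implicit Types f h : S -> R.

Lemma within_continuousD f h : {within A, continuous f} ->
  {within A, continuous h} -> {within A, continuous (fun x => f x + h x)}.
Proof.
move=> cf ch.
apply: (@within_continuous_comp _ (R * R)%type _ _ setT (fun x => (f x, h x))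
  (fun p => p.1 + p.2)) => //; first exact: within_continuous_pair.
by apply: within_continuousW; apply: add_continuous.
Qed.

Lemma within_continuousM f h : {within A, continuous f} ->
  {within A, continuous h} -> {within A, continuous (fun x => f x * h x)}.
Proof.
move=> cf ch.
apply: (@within_continuous_comp _ (R * R)%type _ _ setT (fun x => (f x, h x))
  (fun p => p.1 * p.2)) => //; first exact: within_continuous_pair.
by apply: within_continuousW; apply: mul_continuous.
Qed.

Lemma within_continuousN f : {within A, continuous f} ->
  {within A, continuous (fun x => - f x)}.
Proof.
move=> cf; apply: (within_continuous_comp (B := setT) cf) => //.
by apply: within_continuousW => p; apply: opp_continuous.
Qed.

Lemma within_continuous_cst (T : topologicalType) (c : T) :
  {within A, continuous (fun _ : S => c)}.
Proof. by apply: within_continuousW => p; apply: cvg_cst. Qed.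

End RealContinuity.

Lemma within_continuous_id (S : topologicalType) (A : set S) :
  {within A, continuous (fun x : S => x)}.
Proof. by apply: within_continuousW => p; apply: cvg_id. Qed.

Lemma within_continuous_fst (S T : topologicalType) (A : set (S * T)) :
  {within A, continuous (fun p : S * T => p.1)}.
Proof. by apply: within_continuousW => p; apply: cvg_fst. Qed.

Lemma within_continuous_snd (S T : topologicalType) (A : set (S * T)) :
  {within A, continuous (fun p : S * T => p.2)}.
Proof. by apply: within_continuousW => p; apply: cvg_snd. Qed.

Lemma within_continuous_setT (S T : topologicalType) (f : S -> T) :
  {within setT, continuous f} -> continuous f.
Proof.
move=> /within_continuous_nbhsP cf x P /(cf x I).
by apply: filterS => y; apply.
Qed.

Lemma within_continuous_paste (R : realType) (S T : topologicalType)
    (D : set S) (q : S -> R) (c : R) (f h : S -> T) :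
  {within D, continuous q} ->
  {within D `&` [set x | q x <= c], continuous f} ->
  {within D `&` [set x | c <= q x], continuous h} ->
  (forall x, D x -> q x = c -> f x = h x) ->
  {within D, continuous (fun x => if q x <= c then f x else h x)}.
Proof.
move=> /within_continuous_nbhsP cq /within_continuous_nbhsP cf.
move=> /within_continuous_nbhsP ch fh.
apply/within_continuous_nbhsP => x Dx P.
have [qc|cq'|qc] := ltgtP (q x) c.
- move=> Pf; have := cq x Dx _ (lt_nbhsl qc).
  have := cf x (conj Dx (ltW qc)) P Pf.
  apply: filterS2 => y Py qy Dy; rewrite ifT ?ltW ?qy//.
  by apply: Py; split => //=; rewrite ltW ?qy.
- move=> Ph; have := cq x Dx _ (lt_nbhsr cq').
  have := ch x (conj Dx (ltW cq')) P Ph.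
  apply: filterS2 => y Py qy Dy; rewrite leNgt qy//=.
  by apply: Py; split => //=; rewrite ltW ?qy.
- move=> Pf; have Ph : nbhs (h x) P by rewrite -fh.
  have xl : (D `&` [set x | q x <= c]) x by split => //=; rewrite qc.
  have xr : (D `&` [set x | c <= q x]) x by split => //=; rewrite qc.
  apply: filterS2 (cf x xl P Pf) (ch x xr P Ph) => y Pfy Phy Dy.
  by case: (leP (q y) c) => qy; [apply: Pfy|apply: Phy; split => //=; apply: ltW].
Qed.

Section Homotopic.
Context {R : realType}.
Implicit Types S T U : topologicalType.

Lemma homotopic_sym S T (f h : S -> T) :
  @homotopic R S T f h -> @homotopic R S T h f.
Proof.
move=> [F [cF F0 F1]]; exists (fun p => F (p.1, 1 - p.2)); split => [|x|x] /=.
- apply: (within_continuous_comp _ cF) => [|[x t] [_ /=]].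
    apply: within_continuous_pair; first exact: within_continuous_fst.
    apply: within_continuousD; first exact: within_continuous_cst.
    by apply: within_continuousN; apply: within_continuous_snd.
  by rewrite !in_itv /= => ?; split => //=; lra.
- by rewrite subr0.
- by rewrite subrr.
Qed.

Lemma homotopic_trans S T (f h k : S -> T) :
  @homotopic R S T f h -> @homotopic R S T h k -> @homotopic R S T f k.
Proof.
move=> [F [cF F0 F1]] [H [cH H0 H1]].
exists (fun p => if p.2 <= 1 / 2 then F (p.1, 2 * p.2) else H (p.1, 2 * p.2 - 1)).
split => [|x|x] /=.
- apply: within_continuous_paste.
  + exact: within_continuous_snd.
  + apply: (within_continuous_comp _ cF) => [|[x t] [[_ /=]]].
      apply: within_continuous_pair; first exact: within_continuous_fst.
      apply: within_continuousM; first exact: within_continuous_cst.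
      exact: within_continuous_snd.
    by rewrite !in_itv /= => ? ?; split => //=; lra.
  + apply: (within_continuous_comp _ cH) => [|[x t] [[_ /=]]].
      apply: within_continuous_pair; first exact: within_continuous_fst.
      apply: within_continuousD; last exact: within_continuous_cst.
      apply: within_continuousM; first exact: within_continuous_cst.
      exact: within_continuous_snd.
    by rewrite !in_itv /= => ? ?; split => //=; lra.
  + move=> [x t] _ /= ->.
    rewrite (_ : 2 * (1 / 2) = 1 :> R); last by lra.
    by rewrite subrr F1 H0.
- by rewrite ifT ?mulr0 ?F0//; lra.
- rewrite ifF; last by apply/negbTE; rewrite -ltNge; lra.
  by rewrite (_ : 2 * 1 - 1 = 1 :> R) ?H1//; lra.
Qed.

Lemma homotopic_compl S T U (k : T -> U) (f h : S -> T) : continuous k ->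
  @homotopic R S T f h -> @homotopic R S U (k \o f) (k \o h).
Proof.
move=> ck [F [cF F0 F1]]; exists (k \o F); split => [|x|x] /=.
- by apply: (within_continuous_comp (B := setT) cF) => //; apply: within_continuousW.
- by rewrite F0.
- by rewrite F1.
Qed.

Lemma homotopic_compr S T U (k : U -> S) (f h : S -> T) : continuous k ->
  @homotopic R S T f h -> @homotopic R U T (f \o k) (h \o k).
Proof.
move=> ck [F [cF F0 F1]]; exists (fun p => F (k p.1, p.2)); split => [|x|x] //=.
apply: (within_continuous_comp _ cF) => [|[x t] [_ /=] ?]; last by split.
apply: within_continuous_pair; last exact: within_continuous_snd.
apply: (within_continuous_comp (B := setT)) => //.
  exact: within_continuous_fst.
exact: within_continuousW.
Qed.

Lemma homotopic_continuous S T (f h : S -> T) :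
  @homotopic R S T f h -> continuous h.
Proof.
move=> [F [cF _ F1]]; apply: within_continuous_setT.
apply: (@eq_within_continuous _ _ _ (fun x => F (x, 1))) => [x _|]; first exact: F1.
apply: (within_continuous_comp (f := fun x => (x, 1 : R)) _ cF) => [|x _].
  apply: within_continuous_pair; first exact: within_continuous_id.
  exact: within_continuous_cst.
by split => //=; apply: unit1.
Qed.

Lemma homotopy_inverse_homotopic S T (f : S -> T) (h h' : T -> S) :
  continuous f -> @homotopy_inverse R S T f h -> @homotopic R T S h h' ->
  @homotopy_inverse R S T f h'.
Proof.
move=> cf [ch hf fh] hh'; split; first exact: homotopic_continuous hh'.
- apply: homotopic_trans hf; apply: homotopic_sym; exact: homotopic_compr.
- apply: homotopic_trans fh; apply: homotopic_sym; exact: homotopic_compl.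
Qed.

End Homotopic.

(** * Homotopies assembled edge by edge *)

Section EdgewiseHomotopy.
Context {R : realType} {G : graph R}.
Implicit Types (e : edge G) (x : G) (T : topologicalType).
Context (on_edge : forall x : G, exists e, closed_edge e x).

Definition unit_square : set (R * R) := [set` `[0, 1]] `*` [set` `[0, 1]].

(** The product of the weak topology with an interval is again weak because
    the graph is locally finite: near a point only finitely many closed edges
    matter, and on each of them compactness of the parameter interval gives a
    uniform neighborhood. *)
Lemma homotopy_edgewise T (F : G * R -> T) :
  (forall e, {within unit_square,
    continuous (fun p : R * R => F (charmap e p.1, p.2))}) ->
  {within [set: G] `*` [set` `[0, 1]], continuous F}.
Proof.
move=> cF; apply/within_continuous_nbhsP => -[x t] [_ /= t01] P Pxt.
have [U xU fU] := locally_finite_closed_edges x.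
set D := [set e | _] in fU.
suff H : \forall p \near (x, t), forall e, D e ->
    forall s, s \in `[0, 1] -> charmap e s = p.1 -> p.2 \in `[0, 1] -> P (F p).
  have Ux : \forall p \near (x, t), U p.1.
    by exists (U, setT) => /=; [split => //; exact: filterT|move=> [y u] []].
  apply: filterS2 H Ux => -[y u] /= H Uy [_ /= u01].
  have [e ey] := on_edge y; have [s s01 es] := ey.
  by apply: (H e _ s) => //; exists y; split => //; exists s.
apply: near_finite fU _ => e _.
have /compact_near_coveringP/near_covering_withinP nc :=
  @segment_compact R 0 1.
apply: (nc _ (nbhs (x, t)) (fun p s => charmap e s = p.1 -> p.2 \in `[0, 1] -> P (F p))).
move=> s s01; have [esx|esx] := pselect (charmap e s = x).
  have /within_continuous_nbhsP/(_ (s, t) (conj s01 t01) P) := cF e.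
  rewrite /= esx => /(_ Pxt) [[A B] /= [As Bt] AB].
  exists (A, setT `*` B) => /=.
    by split => //; exists (setT, B) => //=; split => //; exact: filterT.
  move=> [s' [y u]] /= [As' [_ Bu]] s'01 es'y u01.
  by rewrite -es'y; apply: (AB (s', u)).
have := @graph_hausdorff R G; rewrite open_hausdorff => /(_ _ _ (introN eqP esx)).
move=> [[A B] /= [/set_mem As /set_mem Bx] [oA oB /eqP AB]].
have /within_continuous_nbhsP/(_ s s01 A (open_nbhs_nbhs (conj oA As))) :=
  @charmap_continuous R G e => As'.
exists ([set s' | s' \in `[0, 1] -> A (charmap e s')], B `*` setT) => /=.
  split => //; exists (B, setT) => //=; split; last exact: filterT.
  exact: open_nbhs_nbhs.
move=> [s' [y u]] /= [Hs [By _]] s'01 es'y _.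
have : set0 y by rewrite -AB; split => //; rewrite -es'y; apply: Hs.
by [].
Qed.

(** A vertex may be an end of several edges, or both ends of one; the common
    motion m of the vertices is what makes the edge motions compatible. *)
Lemma glue_edgewise T (m : G -> R -> T) (Phi : edge G -> R -> R -> T) :
  (forall e t, t \in `[0, 1] ->
    Phi e 0 t = m (charmap e 0) t /\ Phi e 1 t = m (charmap e 1) t) ->
  exists F : G * R -> T,
    (forall e s t, s \in `[0, 1] -> t \in `[0, 1] ->
      F (charmap e s, t) = Phi e s t) /\
    (forall v t, vertex v -> t \in `[0, 1] -> F (v, t) = m v t).
Proof.
move=> Pm; have /choice[F FP] : forall p : G * R, exists y : T,
    p.2 \in `[0, 1] -> (vertex p.1 -> y = m p.1 p.2) /\
    (forall e s, s \in `[0, 1] -> charmap e s = p.1 -> y = Phi e s p.2).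
  move=> [x t] /=; have [vx|[e0 [s0 s001 xs]]] := graph_cover x.
    exists (m x t) => t01; split => // e s s01 es.
    have [s0|s1] := vertex_charmap s01 (eq_ind_r (fun z => vertex z) vx es).
      by rewrite -es s0; have [-> _] := Pm e t t01.
    by rewrite -es s1; have [_ ->] := Pm e t t01.
  have nvx : ~ vertex x by rewrite xs; apply: charmap_interior.
  exists (Phi e0 s0 t) => t01; split => // e s /unit_itvE[->|->|s01] es.
  - by case: nvx; rewrite -es; have [] := @charmap_ends R G e.
  - by case: nvx; rewrite -es; have [] := @charmap_ends R G e.
  - by move: es; rewrite xs => /charmap_inj[] // -> ->.
exists F; split => [e s t s01 t01|v t vv t01].
  by have [//|_ /(_ e s s01 erefl)] := FP (charmap e s, t).
by have [//|/(_ vv)] := FP (v, t).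
Qed.

Lemma deform_edgewise T (f : G -> T) (m : G -> R -> T)
    (Phi : edge G -> R -> R -> T) :
  (forall e, {within unit_square, continuous (fun p => Phi e p.1 p.2)}) ->
  (forall e s, s \in `[0, 1] -> Phi e s 0 = f (charmap e s)) ->
  (forall e t, t \in `[0, 1] ->
    Phi e 0 t = m (charmap e 0) t /\ Phi e 1 t = m (charmap e 1) t) ->
  exists f' : G -> T,
    [/\ @homotopic R G T f f',
        forall v, vertex v -> f' v = m v 1 &
        forall e s, s \in `[0, 1] -> f' (charmap e s) = Phi e s 1].
Proof.
move=> cP P0 Pm; have [F [FP Fm]] := glue_edgewise Pm.
exists (fun x => F (x, 1)); split.
- exists F; split => // [|x].
    apply: homotopy_edgewise => e; apply: eq_within_continuous (cP e).
    by move=> [s t] [/= s01 t01]; rewrite FP.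
  have [e [s s01 <-]] := on_edge x.
  by rewrite FP ?P0//; apply: unit0.
- by move=> v vv; apply: Fm => //; apply: unit1.
- by move=> e s s01; apply: FP => //; apply: unit1.
Qed.

End EdgewiseHomotopy.

(** * Straightening paths to edge paths *)

(** A substitute for subdividing [0, 1] by a Lebesgue number: the supremum of
    the b with P 0 b is attained, and equals 1. *)
Lemma interval_additive_induction (R : realType) (P : R -> R -> Prop) :
  (forall a b c, P a b -> P b c -> P a c) ->
  (forall x, x \in `[0, 1] -> exists2 d, 0 < d & forall a b,
    a \in `[0, 1] -> b \in `[0, 1] -> a < b ->
    x - d < a -> b < x + d -> P a b) ->
  P 0 1.
Proof.
move=> Padd Ploc; pose S := [set b | [/\ 0 < b, b <= 1 & P 0 b]].
have I0 : (0 : R) \in `[0, 1] by apply: unit0.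
have supS : has_sup S.
  split; last by exists 1 => b [].
  have [d d0 dP] := Ploc 0 I0.
  exists (Num.min (d / 2) 1).
  have [h|h] := leP (d / 2) 1; split; rewrite ?ltr01//; first by lra.
    by apply: dP => //; rewrite ?in_itv /=; lra.
  by apply: dP => //; rewrite ?in_itv /=; lra.
set c := sup S.
have [b0 [b00 b01 Pb0]] := supS.1.
have c0 : 0 < c by apply: (lt_le_trans b00); apply: ub_le_sup => //; case: supS.
have c1 : c <= 1 by apply: ge_sup => [|b []//]; case: supS.
have Ic : c \in `[0, 1] by rewrite in_itv /=; lra.
have [d d0 dP] := Ploc c Ic.
have Pc : P 0 c.
  have [b [bp b1 Pb] cb] := sup_adherent d0 supS.
  have : b <= c by apply: ub_le_sup => //; case: supS.
  rewrite le_eqVlt => /orP[/eqP <-//|bc].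
  apply: (Padd _ _ _ Pb); apply: dP => //; last by lra.
  by rewrite in_itv /=; lra.
have [->//|c1'] := eqVneq 1 c.
have {}c1 : c < 1 by rewrite lt_neqAle eq_sym c1'.
pose b := Num.min (c + d / 2) 1.
have [cb b1 bd] : [/\ c < b, b <= 1 & b < c + d].
  by rewrite /b; case: (leP (c + d / 2)) => ?; split; lra.
have : b <= c.
  apply: ub_le_sup; first by case: supS.
  split; [lra|lra|]; apply: (Padd _ _ _ Pc).
  by apply: dP => //; rewrite ?in_itv /=; lra.
by lra.
Qed.

Section EdgeChains.
Context {R : realType} {G : graph R}.
Implicit Types (e : edge G) (a b c s t : R) (gamma : R -> G).

Definition edge_piece a b gamma : Prop :=
  exists (e : edge G) (fwd : bool) (phi : R -> R),
    [/\ {within `[a, b], continuous phi},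
        {in `[a, b] &, {homo phi : s s' / s < s'}},
        phi a = 0, phi b = 1 &
        forall s, s \in `[a, b] -> gamma s = oriented_edge e fwd (phi s)].

(** Nonconstant edge paths over an arbitrary interval. Unlike a numbered list
    of breakpoints, this form makes concatenation immediate. *)
Inductive edge_chain gamma a : R -> Prop :=
| edge_chain1 b : a < b -> edge_piece a b gamma -> edge_chain gamma a b
| edge_chain_rcons b c : edge_chain gamma a b -> b < c ->
    edge_piece b c gamma -> edge_chain gamma a c.

Lemma edge_chain_lt gamma a b : edge_chain gamma a b -> a < b.
Proof. by elim=> // {}b c _ ab bc _; apply: lt_trans bc. Qed.

Lemma edge_chain_cat gamma a b c :
  edge_chain gamma a b -> edge_chain gamma b c -> edge_chain gamma a c.
Proof.
move=> ab; elim=> [{}c bc p|{}c d _ ac cd p]; last exact: edge_chain_rcons ac cd p.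
exact: edge_chain_rcons ab bc p.
Qed.

Lemma eq_edge_piece gamma gamma' a b :
  (forall s, s \in `[a, b] -> gamma s = gamma' s) ->
  edge_piece a b gamma -> edge_piece a b gamma'.
Proof.
move=> gg [e [fwd [phi [cp ip p0 p1 gp]]]]; exists e, fwd, phi; split => // s sab.
by rewrite -gg// gp.
Qed.

Lemma eq_edge_chain gamma gamma' a b :
  (forall s, s \in `[a, b] -> gamma s = gamma' s) ->
  edge_chain gamma a b -> edge_chain gamma' a b.
Proof.
move=> + ab; elim: ab => [{}b ab p|{}b c ab IH bc p] gg.
  by apply: edge_chain1 => //; apply: eq_edge_piece p.
have {}ab := edge_chain_lt ab.
apply: (edge_chain_rcons (b := b)) => //.
  by apply: IH => s; rewrite in_itv /= => ?; apply: gg; rewrite in_itv /=; lra.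
apply: eq_edge_piece p => s; rewrite in_itv /= => ?.
by apply: gg; rewrite in_itv /=; lra.
Qed.

Lemma edge_chain_path gamma : edge_chain gamma 0 1 -> edge_path gamma.
Proof.
move=> ch; right.
suff H a b : edge_chain gamma a b -> exists (n : nat) (t : nat -> R),
    [/\ t 0%N = a, t n.+1 = b &
      forall i, (i <= n)%N -> t i < t i.+1 /\ edge_piece (t i) (t i.+1) gamma].
  exact: H ch.
elim=> [{}b ab p|{}b c _ [n [t [t0 tn tP]]] bc p].
  by exists 0%N, (fun i => if i is 0 then a else b); split => // -[].
exists n.+1, (fun i => if (i <= n.+1)%N then t i else c); split => //.
  by rewrite ltnn.
move=> i iN; have [ilt|iN'] := ltnP i n.+1.
  by rewrite ltnW//; apply: tP.
have -> : i = n.+1 by apply/eqP; rewrite eqn_leq iN.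
by rewrite leqnn tn.
Qed.

Definition ramp a b s := (s - a) / (b - a).

Lemma ramp_left a b : ramp a b a = 0. Proof. by rewrite /ramp subrr mul0r. Qed.

Lemma ramp_right a b : a < b -> ramp a b b = 1.
Proof. by move=> ab; rewrite /ramp divff//; lra. Qed.

Lemma ramp_unit a b s : a < b -> s \in `[a, b] -> ramp a b s \in `[0, 1].
Proof.
move=> ab; rewrite !in_itv /= => /andP[sa sb]; apply/andP; split.
  by apply: divr_ge0; lra.
by rewrite ler_pdivrMr; lra.
Qed.

Lemma ramp_continuous a b (A : set R) : {within A, continuous (ramp a b)}.
Proof.
apply: within_continuousM; last exact: within_continuous_cst.
apply: within_continuousD; last exact: within_continuous_cst.
exact: within_continuous_id.
Qed.

Lemma edge_piece_ramp a b e fwd : a < b ->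
  edge_piece a b (fun s => oriented_edge e fwd (ramp a b s)).
Proof.
move=> ab; exists e, fwd, (ramp a b); split => //.
- exact: ramp_continuous.
- move=> s s' _ _ ss'; rewrite /ramp ltr_pM2r; first by lra.
  by rewrite invr_gt0; lra.
- exact: ramp_left.
- exact: ramp_right.
Qed.

(** A return trip takes the place of a constant path, so that no constant
    pieces ever have to be removed from a chain. *)
Lemma edge_chain_between e a b (x y : bool) : a < b ->
  exists f : R -> R, [/\ {within `[a, b], continuous f},
    f a = x%:R, f b = y%:R, forall s, s \in `[a, b] -> f s \in `[0, 1] &
    edge_chain (charmap e \o f) a b].
Proof.
move=> ab.
pose one (p q : R) (z : bool) s := if z then 1 - ramp p q s else ramp p q s.
have one_cont p q z (A : set R) : {within A, continuous (one p q z)}.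
  case: z; last exact: ramp_continuous.
  apply: within_continuousD; first exact: within_continuous_cst.
  by apply: within_continuousN; apply: ramp_continuous.
have one_l p q z : one p q z p = z%:R.
  by rewrite /one ramp_left subr0; case: z.
have one_r p q z : p < q -> one p q z q = (~~ z)%:R.
  by move=> pq; rewrite /one ramp_right// subrr; case: z.
have one_I p q z s : p < q -> s \in `[p, q] -> one p q z s \in `[0, 1].
  move=> pq /(ramp_unit pq); rewrite /one; case: z => //.
  by rewrite !in_itv /=; lra.
have one_ch p q z : p < q -> edge_chain (charmap e \o one p q z) p q.
  move=> pq; apply: edge_chain1 => //.
  by apply: eq_edge_piece (edge_piece_ramp e (~~ z) pq) => s _; case: z.
have [yx|yx] := eqVneq y (~~ x).
  exists (one a b x); split; [exact: one_cont|exact: one_l| | |exact: one_ch].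
    by rewrite one_r// yx.
  by move=> s; apply: one_I.
have {}yx : y = x by move: yx; case: x; case: y.
pose m := (a + b) / 2; have am : a < m by rewrite /m; lra.
have mb : m < b by rewrite /m; lra.
exists (fun s => if s <= m then one a m x s else one m b (~~ x) s); split.
- apply: within_continuous_paste; [exact: within_continuous_id|exact: one_cont|
    exact: one_cont|].
  by move=> s _ ->; rewrite one_l one_r.
- by rewrite ltW// one_l.
- by rewrite leNgt mb /= one_r// negbK yx.
- move=> s; rewrite in_itv /= => ?; case: (leP s m) => sm; apply: one_I => //.
    by rewrite in_itv /=; lra.
  by rewrite in_itv /=; lra.
- apply: (edge_chain_cat (b := m)).
    apply: eq_edge_chain (one_ch a m x am) => s.
    by rewrite in_itv /= => /andP[_ sm]; rewrite sm.
  apply: eq_edge_chain (one_ch m b (~~ x) mb) => s.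
  rewrite in_itv /= => /andP[ms sb]; case: (leP s m) => // sm.
  have -> : s = m by lra.
  by rewrite one_l one_r.
Qed.

End EdgeChains.

Section Straightening.
Context {R : realType} {G : graph R}.
Implicit Types (e : edge G) (x y : G) (a b c s t : R).
Context (on_edge : forall x : G, exists e, closed_edge e x).

(** Points inside an edge travel to its initial vertex; for fixed time this is
    not continuous in the point. *)
Definition slide y t : G := xget y [set z |
  (vertex y /\ z = y) \/
  exists e, exists2 s, s \in `]0, 1[ & y = charmap e s /\ z = charmap e ((1 - t) * s)].

Lemma slide_vertex y t : vertex y -> slide y t = y.
Proof.
move=> vy; rewrite /slide; case: xgetP => [z _ [[]//|[e [s s01 [yE _]]]]|//].
by have := @charmap_interior R G e s s01; rewrite -yE.
Qed.

Lemma slide_cell e s t : s \in `]0, 1[ ->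
  slide (charmap e s) t = charmap e ((1 - t) * s).
Proof.
move=> s01; rewrite /slide; case: xgetP => [z _ [[v _]|[e' [s' s'01 []]]]|].
- by have := charmap_interior s01 v.
- by move=> /charmap_inj[]// <- <-.
- by move=> /(_ (charmap e ((1 - t) * s))); case; right; exists e, s.
Qed.

Lemma slide0 y : slide y 0 = y.
Proof.
have [vy|[e [s s01 ->]]] := graph_cover y; first by rewrite slide_vertex.
by rewrite slide_cell// subr0 mul1r.
Qed.

Lemma slide1_vertex y : vertex (slide y 1).
Proof.
have [vy|[e [s s01 ->]]] := graph_cover y; first by rewrite slide_vertex.
by rewrite slide_cell// subrr mul0r; have [] := @charmap_ends R G e.
Qed.

Lemma slide_continuous y : {within `[0, 1], continuous (slide y)}.
Proof.
have [vy|[e [s s01 ->]]] := graph_cover y.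
  apply: (@eq_within_continuous _ _ _ (fun=> y)) => [t _|]; first by rewrite slide_vertex.
  exact: within_continuous_cst.
apply: (@eq_within_continuous _ _ _ (charmap e \o (fun t => (1 - t) * s))).
  by move=> t _; rewrite slide_cell.
apply: (within_continuous_comp _ (@charmap_continuous R G e)) => [|t /=].
  apply: within_continuousM; last exact: within_continuous_cst.
  apply: within_continuousD; first exact: within_continuous_cst.
  by apply: within_continuousN; apply: within_continuous_id.
move: s01; rewrite !in_itv /= => /andP[s0 s1] /andP[t0 t1]; apply/andP; split.
  by apply: mulr_ge0; lra.
by apply: mulr_ile1; lra.
Qed.

(** The endpoints move along a rule that depends only on their position, so
    that straightenings of adjacent intervals fit together. *)
Definition straightens (beta : R -> G) a b : Prop :=
  exists Phi : R -> R -> G,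
    [/\ {within [set` `[a, b]] `*` [set` `[0, 1]],
          continuous (fun p : R * R => Phi p.1 p.2)},
        forall s, s \in `[a, b] -> Phi s 0 = beta s,
        forall t, t \in `[0, 1] ->
          Phi a t = slide (beta a) t /\ Phi b t = slide (beta b) t &
        edge_chain (Phi^~ 1) a b].

Lemma straightens_cat beta a b c :
  straightens beta a b -> straightens beta b c -> straightens beta a c.
Proof.
move=> [Phi [cP P0 Pe Pc]] [Psi [cQ Q0 Qe Qc]].
have ab := edge_chain_lt Pc; have bc := edge_chain_lt Qc.
exists (fun s t => if s <= b then Phi s t else Psi s t); split.
- apply: within_continuous_paste; first exact: within_continuous_fst.
  + apply: continuous_subspaceW cP => -[s t] [[/= + t01] sb].
    by rewrite in_itv /= => ?; split => //=; rewrite in_itv /=; lra.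
  + apply: continuous_subspaceW cQ => -[s t] [[/= + t01] sb].
    by rewrite in_itv /= => ?; split => //=; rewrite in_itv /=; lra.
  + move=> [s t] [/= _ t01] ->.
    by have [_ ->] := Pe t t01; have [-> _] := Qe t t01.
- move=> s; rewrite in_itv /= => ?; case: (leP s b) => sb.
    by apply: P0; rewrite in_itv /=; lra.
  by apply: Q0; rewrite in_itv /=; lra.
- move=> t t01; rewrite (ltW ab) leNgt bc /=.
  by have [-> _] := Pe t t01; have [_ ->] := Qe t t01.
- apply: (edge_chain_cat (b := b)).
    apply: eq_edge_chain Pc => s.
    by rewrite in_itv /= => /andP[_ sb]; rewrite sb.
  apply: eq_edge_chain Qc => s.
  rewrite in_itv /= => /andP[bs sc]; case: (leP s b) => // sb.
  have -> : s = b by lra.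
  have I1 : (1 : R) \in `[0, 1] by apply: unit1.
  by have [_ ->] := Pe 1 I1; have [-> _] := Qe 1 I1.
Qed.

Lemma unit_convex (u v t : R) : u \in `[0, 1] -> v \in `[0, 1] ->
  t \in `[0, 1] -> (1 - t) * u + t * v \in `[0, 1].
Proof.
rewrite !in_itv /= => /andP[u0 u1] /andP[v0 v1] /andP[t0 t1]; apply/andP.
split; first by rewrite addr_ge0// mulr_ge0//; lra.
have : (1 - t) * u <= (1 - t) * 1 by apply: ler_wpM2l => //; lra.
have : t * v <= t * 1 by apply: ler_wpM2l.
by lra.
Qed.

(** Inside one edge the parameters can be moved along straight lines. The end
    values of psi go to 0 unless they equal 1, which is what slide does. *)
Lemma straightens_in_edge beta e (psi : R -> R) a b : a < b ->
  {within `[a, b], continuous psi} ->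
  (forall s, s \in `[a, b] -> psi s \in `[0, 1]) ->
  (forall s, s \in `[a, b] -> beta s = charmap e (psi s)) ->
  straightens beta a b.
Proof.
move=> ab cpsi psi01 bpsi.
have Ia : a \in `[a, b] by rewrite in_itv /=; lra.
have Ib : b \in `[a, b] by rewrite in_itv /=; lra.
have [f [cf fa fb f01 fch]] := edge_chain_between e (psi a == 1) (psi b == 1) ab.
have ends u t : u \in `[0, 1] -> t \in `[0, 1] ->
    charmap e ((1 - t) * u + t * (u == 1)%:R) = slide (charmap e u) t.
  have [v0 v1] := @charmap_ends R G e.
  move=> /unit_itvE[->|->|u01] t01.
  - by rewrite slide_vertex// eq_sym oner_eq0 !mulr0 addr0.
  - by rewrite slide_vertex// eqxx !mulr1 subrK.
  - rewrite slide_cell// (_ : (u == 1) = false) ?mulr0 ?addr0//.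
    by apply/eqP => u1; move: u01; rewrite u1 in_itv /=; lra.
exists (fun s t => charmap e ((1 - t) * psi s + t * f s)); split.
- apply: (@within_continuous_comp _ R _ _ _
    (fun p : R * R => (1 - p.2) * psi p.1 + p.2 * f p.1) _ _
    (@charmap_continuous R G e)) => [|[s t] [/= sab t01]]; last first.
    by apply: unit_convex => //; [apply: psi01|apply: f01].
  have pull (k : R -> R) : {within `[a, b], continuous k} ->
      {within [set` `[a, b]] `*` [set` `[0, 1]], continuous (fun p : R * R => k p.1)}.
    move=> ck; apply: (within_continuous_comp _ ck) => [|p []//].
    exact: within_continuous_fst.
  apply: within_continuousD; apply: within_continuousM.
  + apply: within_continuousD; first exact: within_continuous_cst.
    by apply: within_continuousN; apply: within_continuous_snd.
  + exact: pull.
  + exact: within_continuous_snd.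
  + exact: pull.
- by move=> s sab; rewrite subr0 mul1r mul0r addr0 bpsi.
- by move=> t t01; rewrite fa fb !bpsi// !ends//; apply: psi01.
- by apply: eq_edge_chain fch => s _ /=; rewrite subrr mul0r add0r mul1r.
Qed.

(** Every set of vertices is closed, so the vertices form a discrete space. *)
Lemma connected_vertices_eq (B : set G) x y :
  connected B -> B `<=` vertex (g := G) -> B x -> B y -> x = y.
Proof.
move=> cB BV Bx By.
have VC (A : set G) : A `<=` vertex (g := G) -> closed A.
  move=> AV; apply: closed_edgewise => e; right.
  by apply/seteqP; split => // z [/cell_not_vertex nv /AV].
suff : [set x] = B by move=> E; move: By; rewrite -E => ->.
apply: cB; first by exists x.
  exists (~` (B `\ x)).
    by apply: closed_openC; apply: VC => z [/BV].
  apply/seteqP; split => z; first by move=> ->; split => // -[_]; apply.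
  by move=> [Bz nz]; apply: contrapT => zx; apply: nz.
exists [set x]; first by apply: VC => z ->; apply: BV.
by apply/seteqP; split => z; [move=> ->|move=> []].
Qed.

(** The stretching of the middle third onto the unit interval. *)
Definition clamp s : R := Num.max 0 (Num.min 1 (3 * s - 1)).

Lemma clamp_unit s : clamp s \in `[0, 1].
Proof.
by rewrite in_itv /= /clamp le_max lexx /= ge_max ler01 ge_min lexx.
Qed.

Lemma clamp_eq0 s : s <= 1 / 3 -> clamp s = 0.
Proof. by move=> s13; rewrite /clamp max_l// ge_min; apply/orP; right; lra. Qed.

Lemma clamp_eq1 s : 2 / 3 <= s -> clamp s = 1.
Proof. by move=> s23; rewrite /clamp min_l ?max_r//; lra. Qed.

Lemma clamp_continuous (A : set R) : {within A, continuous clamp}.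
Proof.
have lin : {within A, continuous (fun s : R => 3 * s - 1)}.
  apply: within_continuousD; last exact: within_continuous_cst.
  apply: within_continuousM; first exact: within_continuous_cst.
  exact: within_continuous_id.
apply: (@within_continuous_comp _ R _ _ setT (fun s : R => 3 * s - 1)
  (fun u : R => Num.max 0 (Num.min 1 u))) => //.
apply: within_continuousW => u.
apply: (@continuous_max R R (fun=> 0) (fun u => Num.min 1 u)).
  exact: cvg_cst.
by apply: (@continuous_min R R (fun=> 1) id); [exact: cvg_cst|exact: cvg_id].
Qed.

(** A path may change edges infinitely often while it passes a vertex. Sending
    a neighborhood of each vertex to that vertex makes it constant there. *)
Lemma pinch : exists P : G * R -> G,
  [/\ {within [set: G] `*` [set` `[0, 1]], continuous P},
      forall x, P (x, 0) = x,
      forall v t, vertex v -> t \in `[0, 1] -> P (v, t) = v &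
      forall e s, s \in `[0, 1] -> P (charmap e s, 1) = charmap e (clamp s)].
Proof.
have [|P [PP Pv]] := @glue_edgewise R G G (fun v _ => v)
  (fun e s t => charmap e ((1 - t) * s + t * clamp s)).
  move=> e t _; rewrite clamp_eq0; last by lra.
  rewrite clamp_eq1; last by lra.
  by rewrite !mulr0 !mulr1 addr0 subrK.
exists P; split => //.
- apply: homotopy_edgewise => // e.
  apply: (@eq_within_continuous _ _ _
    (fun p : R * R => charmap e ((1 - p.2) * p.1 + p.2 * clamp p.1))).
    by move=> [s t] [/= s01 t01]; rewrite PP.
  apply: (@within_continuous_comp _ R _ _ _
    (fun p : R * R => (1 - p.2) * p.1 + p.2 * clamp p.1) _ _
    (@charmap_continuous R G e)) => [|[s t] [/= sab t01]]; last first.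
    by apply: unit_convex => //; apply: clamp_unit.
  apply: within_continuousD; apply: within_continuousM.
  + apply: within_continuousD; first exact: within_continuous_cst.
    by apply: within_continuousN; apply: within_continuous_snd.
  + exact: within_continuous_fst.
  + exact: within_continuous_snd.
  + apply: (within_continuous_comp (B := setT)) => //; first exact: within_continuous_fst.
    exact: clamp_continuous.
- move=> x; have [e [s s01 <-]] := on_edge x.
  by rewrite PP// ?subr0 ?mul1r ?mul0r ?addr0//; apply: unit0.
- by move=> e s s01; rewrite PP ?subrr ?mul0r ?add0r ?mul1r//; apply: unit1.
Qed.

(** After pinching, a short piece of path stays in one closed edge: near a
    point of a middle third the path itself stays in one edge, and away from
    the middle thirds the pinched path takes its values in the discrete set of
    vertices and is therefore constant. *)
Lemma straightens_local (P : G * R -> G) (alpha : R -> G) :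
  {within [set: G] `*` [set` `[0, 1]], continuous P} ->
  (forall e s, s \in `[0, 1] -> P (charmap e s, 1) = charmap e (clamp s)) ->
  {within `[0, 1], continuous alpha} ->
  forall x : R, x \in `[0, 1] -> exists2 d, 0 < d & forall a b,
    a \in `[0, 1] -> b \in `[0, 1] -> a < b ->
    x - d < a -> b < x + d -> straightens (fun s => P (alpha s, 1)) a b.
Proof.
move=> cP P1 ca x x01.
have near_x (O : set G) : open O -> O (alpha x) -> exists2 d, 0 < d &
    forall a b s, a \in `[0, 1] -> b \in `[0, 1] -> a < b ->
    x - d < a -> b < x + d -> s \in `[a, b] -> O (alpha s).
  move=> oO Ox; have /within_continuous_nbhsP/(_ x x01 O) := ca.
  move=> /(_ (open_nbhs_nbhs (conj oO Ox))) /nbhs_ballP[d /= d0 dP].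
  exists d => // a b s; rewrite !in_itv /= => ? ? ? ? ? ?.
  by apply: dP; rewrite /ball /= ?in_itv /= ?ltr_distlC; lra.
have sub_I a b : a \in `[0, 1] -> b \in `[0, 1] ->
    forall s, s \in `[a, b] -> s \in `[0, 1].
  by rewrite !in_itv /= => ? ? s; rewrite !in_itv /= => ?; lra.
pose core : set G := [set y | exists e, exists2 s,
  s \in `[1 / 3, 2 / 3] & y = charmap e s].
have closed_core : closed core.
  apply: graph_weak => e.
  rewrite (_ : _ `&` _ = [set` `[1 / 3, 2 / 3]]); first exact: interval_closed.
  apply/seteqP; split => s; last first.
    move=> s13; split; last by exists e, s.
    by move: s13; rewrite /= !in_itv /= => ?; lra.
  move=> [/= s01 [e' [s' s'13 ss']]].
  have s'01 : s' \in `]0, 1[ by move: s'13; rewrite !in_itv /= => ?; lra.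
  have /unit_itvE[s0|s1|s01'] := s01.
  - have := @charmap_interior R G e' _ s'01; rewrite -ss' s0.
    by have [] := @charmap_ends R G e.
  - have := @charmap_interior R G e' _ s'01; rewrite -ss' s1.
    by have [] := @charmap_ends R G e.
  - by have [_ ->] := charmap_inj s01' s'01 ss'.
have [Cx|nCx] := pselect (core (alpha x)).
  have [e [s0 s013 xs0]] := Cx.
  have ex : cell e (alpha x).
    have s001 : s0 \in `]0, 1[ by move: s013; rewrite !in_itv /= => ?; lra.
    by exists s0.
  have [d d0 dP] := near_x _ (open_cell e) ex.
  exists d => // a b a01 b01 ab xa bx.
  have [c [cK cc]] := cell_coordinate e.
  have ecell s : s \in `[a, b] -> cell e (alpha s) by apply: dP.
  have cE s : s \in `[a, b] ->
      c (alpha s) \in `[0, 1] /\ alpha s = charmap e (c (alpha s)).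
    by move=> /ecell[u u01 <-]; rewrite cK//; split => //; apply: open_unitW.
  apply: (@straightens_in_edge _ e (clamp \o (c \o alpha))) => //.
  - apply: (within_continuous_comp (B := setT)) => //; last exact: clamp_continuous.
    apply: (within_continuous_comp (B := cell e) _ cc) => //.
    by apply: continuous_subspaceW ca => s; apply: sub_I.

  - by move=> s _; apply: clamp_unit.
  - by move=> s sab; have [? ->] := cE s sab; rewrite /= P1// cK//; case: (ecell s sab).
have [d d0 dP] := near_x _ (closed_openC closed_core) nCx.
exists d => // a b a01 b01 ab xa bx.
set beta := fun s => _.
have bV : beta @` [set` `[a, b]] `<=` vertex (g := G).
  move=> _ [s sab <-]; rewrite /beta.
  have := dP a b s a01 b01 ab xa bx sab.
  have [e [u u01 <-]] := on_edge (alpha s); rewrite P1// => nC.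
  have [v0 v1] := @charmap_ends R G e.
  have [u13|u13] := ltP u (1 / 3).
    by rewrite clamp_eq0// ltW.
  have [u23|u23] := ltP (2 / 3) u.
    by rewrite clamp_eq1// ltW.
  by case: nC; exists e, u => //; rewrite in_itv /= u13.
have Ia : a \in `[a, b] by rewrite in_itv /=; lra.
have bcst s : s \in `[a, b] -> beta s = beta a.
  move=> sab; apply: connected_vertices_eq bV _ _; [|by exists s|by exists a].
  apply: connected_continuous_connected.
    by apply/connected_intervalP; apply: interval_is_interval.
  apply: (within_continuous_comp (f := fun s => (alpha s, 1 : R)) _ cP).
    apply: within_continuous_pair; last exact: within_continuous_cst.
    by apply: continuous_subspaceW ca => z; apply: sub_I.
  by move=> z _; split => //=; apply: unit1.
have va : vertex (beta a) by apply: bV; exists a.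
have [e ea] := on_edge (beta a).
have [u u01 eu] := ea.
apply: (@straightens_in_edge _ e (fun=> u)) => //.
- exact: within_continuous_cst.
- by move=> s sab; rewrite eu bcst.
Qed.

(** Cellular approximation of a path relative to its endpoints: first pinch,
    then straighten. The endpoints stay put because they are vertices. *)
Lemma path_straighten (alpha : R -> G) :
  {within `[0, 1], continuous alpha} ->
  vertex (alpha 0) -> vertex (alpha 1) ->
  exists Phi : R -> R -> G,
    [/\ {within unit_square, continuous (fun p : R * R => Phi p.1 p.2)},
        forall s, s \in `[0, 1] -> Phi s 0 = alpha s,
        forall t, t \in `[0, 1] -> Phi 0 t = alpha 0 /\ Phi 1 t = alpha 1 &
        edge_chain (Phi^~ 1) 0 1].
Proof.
move=> ca v0 v1; have [P [cP P0 Pv P1]] := pinch.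
have I0 : (0 : R) \in `[0, 1] by apply: unit0.
have I1 : (1 : R) \in `[0, 1] by apply: unit1.
have [Phi [cPhi Phi0 Phie Phic]] : straightens (fun s => P (alpha s, 1)) 0 1.
  apply: interval_additive_induction; first exact: straightens_cat.
  exact: straightens_local.
exists (fun s t => if t <= 1 / 2 then P (alpha s, 2 * t) else Phi s (2 * t - 1)).
split.
- apply: within_continuous_paste; first exact: within_continuous_snd.
  + apply: (within_continuous_comp
      (f := fun p : R * R => (alpha p.1, 2 * p.2)) _ cP) => [|[s t] [[/= _ +]]].
      apply: within_continuous_pair.
        apply: (within_continuous_comp _ ca) => [|p [[]//]].
        exact: within_continuous_fst.
      apply: within_continuousM; first exact: within_continuous_cst.
      exact: within_continuous_snd.
    by rewrite in_itv /= => ? ?; split => //=; rewrite in_itv /=; lra.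
  + apply: (within_continuous_comp (f := fun p : R * R => (p.1, 2 * p.2 - 1)) _ cPhi)
      => [|[s t] [[/= s01 +]]].
      apply: within_continuous_pair; first exact: within_continuous_fst.
      apply: within_continuousD; last exact: within_continuous_cst.
      apply: within_continuousM; first exact: within_continuous_cst.
      exact: within_continuous_snd.
    by rewrite in_itv /= => ? ?; split => //=; rewrite in_itv /=; lra.
  + move=> [s t] [/= s01 _] ->.
    rewrite (_ : 2 * (1 / 2) = 1 :> R); last by lra.
    by rewrite subrr Phi0.
- by move=> s s01; rewrite ifT ?mulr0 ?P0//; lra.
- move=> t; rewrite in_itv /= => t01; case: (leP t) => t2.
    by rewrite !Pv// in_itv /=; lra.
  have t'01 : 2 * t - 1 \in `[0, 1] by rewrite in_itv /=; lra.
  by have [-> ->] := Phie _ t'01; rewrite !Pv ?slide_vertex.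
- apply: eq_edge_chain Phic => s _; rewrite ifF; last first.
    by apply/negbTE; rewrite -ltNge; lra.
  by rewrite (_ : 2 * 1 - 1 = 1 :> R)//; lra.
Qed.

End Straightening.

(** * Extending and approximating maps of graphs *)

Section SideFilling.
Context {R : realType} {T : topologicalType}.
Implicit Types (p q alpha : R -> T) (s t u : R).

(** The path p backwards, then alpha, then q, on [-1, 2]. *)
Definition side_path p alpha q u : T :=
  if u <= 0 then p (- u) else if u <= 1 then alpha u else q (u - 1).

(** The square with bottom alpha and sides p and q: at time t the side path
    is run on the interval [- t, 1 + t]. *)
Definition side_fill p alpha q s t : T :=
  side_path p alpha q ((1 + 2 * t) * s - t).

Lemma side_fillP p alpha q :
  {within `[0, 1], continuous p} -> {within `[0, 1], continuous alpha} ->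
  {within `[0, 1], continuous q} -> p 0 = alpha 0 -> q 0 = alpha 1 ->
  [/\ {within @unit_square R,
        continuous (fun z : R * R => side_fill p alpha q z.1 z.2)},
      forall s, s \in `[0, 1] -> side_fill p alpha q s 0 = alpha s &
      forall t, t \in `[0, 1] ->
        side_fill p alpha q 0 t = p t /\ side_fill p alpha q 1 t = q t].
Proof.
move=> c0 ca c1 e0 e1.
have cU : {within `[-1, 2], continuous (side_path p alpha q)}.
  apply: within_continuous_paste; first exact: within_continuous_id.
  - apply: (within_continuous_comp _ c0) => [|u [/=]].
      by apply: within_continuousN; apply: within_continuous_id.
    by rewrite !in_itv /= => ? ?; lra.
  - apply: within_continuous_paste; first exact: within_continuous_id.
    + apply: continuous_subspaceW ca => u [[/=]].
      by rewrite !in_itv /= => ? ? ?; lra.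
    + apply: (within_continuous_comp _ c1) => [|u [[/=]]].
        apply: within_continuousD; first exact: within_continuous_id.
        exact: within_continuous_cst.
      by rewrite !in_itv /= => ? ? ?; lra.
    + by move=> u _ ->; rewrite subrr.
  - by move=> u _ ->; rewrite oppr0 ler01.
rewrite /side_fill; split.
- apply: (@within_continuous_comp _ R _ _ _
    (fun z : R * R => (1 + 2 * z.2) * z.1 - z.2) _ _ cU) => [|[s t] [/=]].
    apply: within_continuousD; last first.
      by apply: within_continuousN; apply: within_continuous_snd.
    apply: within_continuousM; last exact: within_continuous_fst.
    apply: within_continuousD; first exact: within_continuous_cst.
    apply: within_continuousM; first exact: within_continuous_cst.
    exact: within_continuous_snd.
  rewrite !in_itv /= => /andP[s0 s1] /andP[t0 t1].
  have : 0 <= (1 + 2 * t) * s by apply: mulr_ge0; lra.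
  have : (1 + 2 * t) * s <= (1 + 2 * t) * 1 by apply: ler_wpM2l; lra.
  by move=> ? ?; lra.
- move=> s; rewrite in_itv /= => /andP[s0 s1].
  rewrite mulr0 addr0 mul1r subr0 /side_path s1; case: (leP s 0) => // sl.
  have -> : s = 0 by lra.
  by rewrite oppr0.
- move=> t; rewrite in_itv /= => /andP[t0 t1]; split; rewrite /side_path.
    by rewrite ifT ?mulr0 ?add0r ?opprK//; lra.
  rewrite ifF; last by apply/negbTE; rewrite -ltNge; lra.
  case: (leP _ 1) => t'; last by congr q; lra.
  have -> : t = 0 by lra.
  by rewrite mulr0 addr0 mulr1 subr0.
Qed.

End SideFilling.

Section CellularExtension.
Context {R : realType} {G : graph R}.
Implicit Types (e : edge G) (s t : R).
Context (on_edge : forall x : G, exists e, closed_edge e x).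

(** The homotopy extension property of the pair (graph, A) combined with
    cellular approximation off A. First h is deformed along D on A, and along
    slide at the other vertices, each remaining edge being dragged along by
    its two ends; then the images of these edges, now paths between vertices,
    are straightened relative to their ends. *)
Lemma cellular_extension (A : set G) (h k : G -> G) (D : G * R -> G) :
  saturated A -> continuous h ->
  {within A `*` [set` `[0, 1]], continuous D} ->
  (forall a, A a -> D (a, 0) = h a /\ D (a, 1) = k a) ->
  (forall v, A v -> vertex v -> vertex (k v)) ->
  exists g' : G -> G,
    [/\ @homotopic R G G h g',
        forall a, A a -> g' a = k a,
        forall v, vertex v -> vertex (g' v) &
        forall e, ~ closed_edge e `<=` A -> edge_path (g' \o charmap e)].
Proof.
move=> sA ch cD D01 kv.
have I0 : (0 : R) \in `[0, 1] by apply: unit0.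
have I1 : (1 : R) \in `[0, 1] by apply: unit1.
pose m v t := if `[< A v >] then D (v, t) else slide (h v) t.
have cm v : {within `[0, 1], continuous (m v)}.
  rewrite /m; case: asboolP => Av; last exact: slide_continuous.
  apply: (@within_continuous_comp _ _ _ _ _ (fun t => (v, t)) _ _ cD) => [|t t01].
    apply: within_continuous_pair; last exact: within_continuous_id.
    exact: within_continuous_cst.
  by split.
have m0 v : m v 0 = h v.
  by rewrite /m; case: asboolP => [/D01[]//|_]; exact: slide0.
have m1 v : vertex v -> vertex (m v 1).
  move=> vv; rewrite /m; case: asboolP => [Av|_]; last exact: slide1_vertex.
  by have [_ ->] := D01 _ Av; apply: kv.
pose Phi e s t := if `[< closed_edge e `<=` A >] then D (charmap e s, t)
  else side_fill (m (charmap e 0)) (h \o charmap e) (m (charmap e 1)) s t.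
have che e : {within `[0, 1], continuous (h \o charmap e)}.
  apply: (within_continuous_comp (B := setT)) => //.
    exact: charmap_continuous.
  exact: within_continuousW.
have fillP e := @side_fillP R G (m (charmap e 0)) (h \o charmap e)
  (m (charmap e 1)) (cm _) (che e) (cm _) (m0 _) (m0 _).
have [|||h1 [hh1 h1v h1e]] := @deform_edgewise R G on_edge G h m Phi.
- move=> e; rewrite /Phi; case: asboolP => eA; last by have [] := fillP e.
  apply: (@within_continuous_comp _ _ _ _ _
    (fun p : R * R => (charmap e p.1, p.2)) _ _ cD) => [|[s t] [/= s01 t01]].
    apply: within_continuous_pair; last exact: within_continuous_snd.
    apply: (within_continuous_comp _ (@charmap_continuous R G e)) => [|p []//].
    exact: within_continuous_fst.
  by split => //; apply: eA; exists s.
- move=> e s s01; rewrite /Phi; case: asboolP => eA.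
    by have [|-> _] := D01 (charmap e s) => //; apply: eA; exists s.
  by have [_ /(_ s s01) -> _] := fillP e.
- move=> e t t01; rewrite /Phi; case: asboolP => eA.
    rewrite /m !asboolT//; first by apply: eA; exists 1.
    by apply: eA; exists 0.
  by have [_ _ /(_ t t01)] := fillP e.
have ch1 : continuous h1 := homotopic_continuous hh1.
have h1A a : A a -> h1 a = k a.
  move=> Aa; have [va|[e [s s01 ae]]] := graph_cover a.
    by rewrite h1v// /m asboolT//; have [] := D01 _ Aa.
  have eA : closed_edge e `<=` A by apply: sA Aa; exists s.
  rewrite {1}ae h1e; last exact: open_unitW.
  by rewrite /Phi asboolT// -ae; have [] := D01 _ Aa.
have vh1 v : vertex v -> vertex (h1 v) by move=> vv; rewrite h1v//; apply: m1.
have ch1e e : {within `[0, 1], continuous (h1 \o charmap e)}.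
  apply: (within_continuous_comp (B := setT)) => //.
    exact: charmap_continuous.
  exact: within_continuousW.
have /choice[Psi PsiP] : forall e, exists Psi : R -> R -> G,
  [/\ {within unit_square, continuous (fun p : R * R => Psi p.1 p.2)},
      forall s, s \in `[0, 1] -> Psi s 0 = h1 (charmap e s),
      forall t, t \in `[0, 1] ->
        Psi 0 t = h1 (charmap e 0) /\ Psi 1 t = h1 (charmap e 1),
      closed_edge e `<=` A -> forall s, Psi s 1 = h1 (charmap e s) &
      ~ closed_edge e `<=` A -> edge_chain (Psi^~ 1) 0 1].
  move=> e; have [eA|neA] := pselect (closed_edge e `<=` A).
    exists (fun s _ => h1 (charmap e s)); split => //.
    apply: (within_continuous_comp _ (ch1e e)) => [|p []//].
    exact: within_continuous_fst.
  have [v0 v1] := @charmap_ends R G e.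
  have [Psi [? ? ? ?]] := path_straighten on_edge (ch1e e) (vh1 _ v0) (vh1 _ v1).
  by exists Psi; split.
have [|||g' [hg' g'v g'e]] :=
  @deform_edgewise R G on_edge G h1 (fun v _ => h1 v) Psi.
- by move=> e; have [] := PsiP e.
- by move=> e; have [] := PsiP e.
- by move=> e; have [] := PsiP e.
exists g'; split.
- exact: homotopic_trans hg'.
- move=> a Aa; rewrite -h1A//; have [va|[e [s s01 ae]]] := graph_cover a.
    exact: g'v.
  have eA : closed_edge e `<=` A by apply: sA Aa; exists s.
  rewrite ae g'e; last exact: open_unitW.
  by have [_ _ _ ->] := PsiP e.
- by move=> v vv; rewrite g'v//; apply: vh1.
- move=> e neA; apply: edge_chain_path.
  have [_ _ _ _ /(_ neA)] := PsiP e; apply: eq_edge_chain => s s01.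
  by rewrite /= g'e.
Qed.

End CellularExtension.

Section EdgeHomeomorphism.
Context {R : realType} {G : graph R}.
Implicit Types (e : edge G) (s t : R).

Lemma eq_on_closed_unit (T : topologicalType) (f h : R -> T) :
  hausdorff_space T ->
  {within `[0, 1], continuous f} -> {within `[0, 1], continuous h} ->
  (forall s, s \in `]0, 1[ -> f s = h s) -> forall s, s \in `[0, 1] -> f s = h s.
Proof.
move=> hT /within_continuous_nbhsP cf /within_continuous_nbhsP ch fh s s01.
apply: contrapT => /eqP; move: hT; rewrite open_hausdorff => /[apply].
move=> [[A B] /= [/set_mem As /set_mem Bs] [oA oB /eqP AB]].
have : \forall u \near s, (u \in `[0, 1] -> A (f u)) /\ (u \in `[0, 1] -> B (h u)).
  apply: filterI; first exact: cf s01 _ (open_nbhs_nbhs (conj oA As)).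
  exact: ch s01 _ (open_nbhs_nbhs (conj oB Bs)).
move=> /nbhs_ballP[d /= d0 dP].
have [u u01 us] := near_open_unit s01 d0.
have [/(_ (open_unitW u01)) Au /(_ (open_unitW u01)) Bu] := dP _ us.
have : set0 (f u) by rewrite -AB; split => //; rewrite fh.
by [].
Qed.

(** In the coordinate of the edge e, gamma is continuous and injective, hence
    monotone; a monotone bijection of open intervals extends continuously to
    the closed ones. *)
Lemma edge_path_homeomorphism (gamma : R -> G) e :
  {within `[0, 1], continuous gamma} ->
  (forall s, s \in `]0, 1[ -> cell e (gamma s)) ->
  {in `]0, 1[ &, injective gamma} ->
  cell e `<=` gamma @` `]0, 1[ ->
  edge_path gamma.
Proof.
move=> cg ge ig sg; have [c [cK cc]] := cell_coordinate e.
have cI s : s \in `]0, 1[ ->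
    (c (gamma s) \in `]0, 1[) /\ gamma s = charmap e (c (gamma s)).
  by move=> /ge[u u01 <-]; rewrite cK.
have csurj u : u \in `]0, 1[ -> exists2 s, s \in `]0, 1[ & c (gamma s) = u.
  move=> u01; have [|s s01 gs] := sg (charmap e u); first by exists u.
  by exists s => //; rewrite gs cK.
have cpsi : {within [set` `]0, 1[], continuous (c \o gamma)}.
  apply: (within_continuous_comp (B := cell e) _ cc) => //.
  by apply: continuous_subspaceW cg => s; apply: open_unitW.
have ipsi : {in `]0, 1[ &, injective (c \o gamma)}.
  move=> s t s01 t01 /= st; apply: ig => //.
  by have [_ ->] := cI s s01; have [_ ->] := cI t t01; rewrite st.
(* Up to the orientation fwd, the parameter change phi is increasing. *)
suff [fwd [phi [iphi phiI phis gphi]]] : exists fwd (phi : R -> R),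
    [/\ {in `]0, 1[ &, {homo phi : s t / s < t}},
        forall s, s \in `]0, 1[ -> phi s \in `]0, 1[,
        forall u, u \in `]0, 1[ -> exists2 s, s \in `]0, 1[ & phi s = u &
        forall s, s \in `]0, 1[ -> gamma s = oriented_edge e fwd (phi s)].
  pose f s := if s <= 0 then 0 else if 1 <= s then 1 else phi s.
  have f0 : f 0 = 0 by rewrite /f lexx.
  have f1 : f 1 = 1 by rewrite /f lexx ler10.
  have fphi s : s \in `]0, 1[ -> f s = phi s.
    by rewrite in_itv /= => /andP[s0 s1]; rewrite /f !leNgt s0 s1.
  have fI s : s \in `[0, 1] -> f s \in `[0, 1].
    move=> /unit_itvE[->|->|s01]; rewrite ?f0 ?f1; [exact: unit0|exact: unit1|].
    by rewrite fphi//; apply/open_unitW/phiI.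
  have finc : {in `[0, 1] &, {homo f : s t / s < t}}.
    move=> s t /unit_itvE[->|->|s01] /unit_itvE[->|->|t01];
      rewrite ?ltxx ?f0 ?f1 ?ltr01 ?ltr10// ?fphi//.
    - by move: (phiI _ t01); rewrite in_itv /= => /andP[].
    - by move: t01; rewrite in_itv /= => ? ?; lra.
    - by move: s01; rewrite in_itv /= => ? ?; lra.
    - by move: (phiI _ s01); rewrite in_itv /= => /andP[].
    - exact: iphi.
  have cf : {within `[0, 1], continuous f}.
    apply: segment_inc_surj_continuous.
      exact: le_mono_in finc.
    rewrite f0 f1 => u /= /unit_itvE[->|->|u01].
    - by exists 0 => //; apply: unit0.
    - by exists 1 => //; apply: unit1.
    - have [s s01 <-] := phis u u01; exists s; first exact: open_unitW.
      exact: fphi.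
  apply: edge_chain_path; apply: edge_chain1 => //.
  exists e, fwd, f; split => //.
  apply: eq_on_closed_unit => //; first exact: graph_hausdorff.
    apply: (@within_continuous_comp _ R _ _ _
      (fun s => if fwd then f s else 1 - f s) _ _
      (@charmap_continuous R G e)) => [|s /= /fI]; last first.
      by rewrite !in_itv /= => ?; case: (fwd); lra.
    case: (fwd) => //; apply: within_continuousD; first exact: within_continuous_cst.
    exact: within_continuousN.
  by move=> s s01; rewrite fphi ?gphi.
have [] := itv_continuous_inj_mono cpsi ipsi.
  move=> mono; exists true, (c \o gamma); split => //.

  - by move=> s /cI[].
  - by move=> s /cI[].
move=> mono; exists false, (fun s => 1 - c (gamma s)); split => //.
- by move=> s t s01 t01 st; rewrite ltrD2l ltrN2; apply: mono.
- by move=> s /cI[]; rewrite !in_itv /= => ? _; lra.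
- move=> u u01; have [|s s01 cs] := csurj (1 - u).
    by move: u01; rewrite !in_itv /= => ?; lra.
  by exists s => //; rewrite cs subKr.
- by move=> s /cI[_ {1}->]; rewrite /oriented_edge subKr.
Qed.

End EdgeHomeomorphism.

(** * Ranges of end-periodic maps near the ends *)

Lemma finite_nat_bounded (D : set nat) : finite_set D ->
  exists N, forall n, D n -> (n < N)%N.
Proof.
move=> fD; pattern D; apply: finite_set_ind fD => [|{}D i [N NP]].
  by exists 0%N.
exists (maxn N i.+1) => n [->|/NP nN]; first by rewrite leq_max ltnSn orbT.
by rewrite leq_max nN.
Qed.

Section Dynamics.
Context {R : realType} {G : graph R}.
Context (G_infinite : graph_infinite G) (G_connected : connected [set: G]).
Context (G_ends : finite_set (@ends R G)).
Context (g : G -> G) (g_map : graph_map g).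
Context (U : set (nat -> set G) -> set G).
Context (U_nbhd : forall E, ends E -> end_nbhd E (U E)).
Let H := largest_subgraph (\bigcup_(E in @ends R G) U E).
Context (g_inj : forall x y, H x -> H y -> g x = g y -> x = y).
Context (g_cell : forall e : edge G, cell e `<=` H ->
  exists e' : edge G, g @` cell e = cell e').
Context (p : nat) (p_gt0 : (0 < p)%N).
Implicit Types (x y z : G) (K : set G) (E : set (nat -> set G)).

Lemma iter_continuous n : continuous (iter n g).
Proof.
have [cg _ _] := g_map; elim: n => [|n IH] x; first exact: cvg_id.
exact: (continuous_comp (IH x) (cg (iter n g x))).
Qed.

Lemma compact_orbit K : compact K -> exists2 K', compact K' &
  forall i x, (i <= p)%N -> K x -> K' (iter i g x).
Proof.
move=> cK; exists (\bigcup_(i in `I_p.+1) (iter i g @` K)).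
  apply: compact_bigcup => [|i _]; first exact: finite_II.
  apply: continuous_compact => //; apply: within_continuousW.
  exact: iter_continuous.
by move=> i x ip Kx; exists i => //; exists x.
Qed.

Lemma embedded_part_cocompact : in_compact (~` H).
Proof. by apply: in_compact_largest_subgraph; apply: ends_cover. Qed.

Lemma iter_inj m x y : (forall i, (i < m)%N -> H (iter i g x)) ->
  (forall i, (i < m)%N -> H (iter i g y)) ->
  iter m g x = iter m g y -> x = y.
Proof.
elim: m => // m IH Hx Hy /= gxy; apply: IH => [i im|i im|].
- by apply: Hx; apply: ltnW.
- by apply: Hy; apply: ltnW.
- by apply: g_inj => //; [apply: Hx|apply: Hy].
Qed.

(** The cell, of dimension 0 or 1, through a point. *)
Definition carrier y : set G :=
  [set z | z = y \/ exists e, cell e y /\ cell e z].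

(** As long as the orbit of x stays in H, each step maps the cell through it
    onto a cell, so the orbit of a neighbor in the last cell can be traced back
    through the same cells. *)
Lemma carrier_lift m x z : (forall i, (i < m)%N -> H (iter i g x)) ->
  carrier (iter m g x) z ->
  exists2 y, iter m g y = z & forall i, (i < m)%N -> H (iter i g y).
Proof.
elim: m z => [|m IH] z Hx; first by exists z.
move=> xz; set w := iter m g x; have Hw : H w by apply: Hx.
have [w' [ww' Hw' gw']] : exists w', [/\ carrier w w', H w' & g w' = z].
  case: xz => [->|[e [ew ez]]]; first by exists w; split => //; left.
  have [vw|[e0 [s s01 ws]]] := graph_cover w.
    have [_ gv _] := g_map; have /cell_not_vertex := ew.
    by case; apply: gv; exists w.
  have e0w : cell e0 w by exists s.
  have e0H : cell e0 `<=` H.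
    by move=> y /cell_closed_edge; apply: (saturated_largest_subgraph e0w).
  have [e' ge0] := g_cell e0H.
  have ee' : e = e'.
    by apply: (cell_inj ew); rewrite -ge0; exists w.
  have [w' e0w' gw'] : (g @` cell e0) z by rewrite ge0 -ee'.
  by exists w'; split => //; [right; exists e0|apply: e0H].
have [|y my Hy] := IH w' _ ww'; first by move=> i im; apply: Hx; apply: ltnW.
exists y => [|i]; first by rewrite iterS my.
by rewrite ltnS leq_eqVlt => /predU1P[->|/Hy//]; rewrite my.
Qed.

Lemma finite_carriers K : compact K -> finite_set (carrier @` K).
Proof.
move=> cK; apply: (@sub_finite_set _ _
  (set1 @` (\bigcup_(y in K) [set v | v = y /\ vertex v]) `|`
   (@cell R G) @` [set e | K `&` closed_edge e !=set0])).
  move=> _ [y Ky <-]; have [vy|[e [s s01 ys]]] := graph_cover y; [left|right].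
    exists y; first by exists y.
    apply/seteqP; split => z; first by move=> ->; left.
    by move=> [//|[e [/cell_not_vertex]]].
  have ey : cell e y by exists s.
  exists e; first by exists y; split => //; apply: cell_closed_edge.
  apply/seteqP; split => z; first by move=> ez; right; exists e.
  by move=> [->//|[e' [e'y e'z]]]; rewrite (cell_inj ey e'y).
rewrite finite_setU; split; apply: finite_image; last exact: compact_meets_finite.
apply: compact_locally_finite => // x.
have [V xV [fV _]] := @graph_locally_finite R G x; exists V => //.
by apply: sub_finite_set fV => v [y Vy [-> vy]].
Qed.

(** Backward iterates of a neighborhood shrink to the end, and g maps the
    difference of two consecutive ones injectively, cell by cell, to the
    previous difference. Far out each difference meets only finitely many
    cells. A point outside the range of g in the k-th difference pushes forward
    to a cell of a fixed difference, and different k give different cells;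
    hence this happens for finitely many k only. *)
Lemma repelling_range E : ends E -> repelling g p E (U E) ->
  exists n, iter (p * n) g @^-1` U E `<=` range g.
Proof.
move=> eE [_]; set W := fun n => _ => EW.
have bW : end_basis W := end_basisW eE EW.
have Wle := end_basis_le bW.
have WS j k x : W (j + k)%N x <-> W k (iter (p * j) g x).
  by rewrite /W /= -iterD mulnDr addnC.
have [C cC HC] := embedded_part_cocompact.
have [C' cC' CC'] := compact_orbit cC.
have [N1 N1P] := end_basis_avoids bW cC'.
(* If g^i x were not in H, it would be in C, and g^p x in C' and in W k.-1. *)
have N1H k x i : (N1 < k)%N -> W k x -> (i < p)%N -> H (iter i g x).
  case: k => // k Nk Wx ip; apply: contrapT => nH.
  have : (W k `&` C') (iter p g x).
    split; first by have := (WS 1%N k x).1; rewrite muln1 add1n; apply.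
    rewrite -(subnK (ltnW ip)) iterD; apply: CC'; last exact: HC.
    exact: leq_subr.
  by rewrite N1P.
have [N2 _ N2P] : \forall n \near \oo, forall E', (ends E' /\ E' <> E) ->
    U E' `&` W n = set0.
  apply: near_finite => [|E' [eE' ne]].
    by apply: sub_finite_set G_ends => E' [].
  have [_ _ /(_ E eE (nesym ne) W EW)] := U_nbhd eE'.
  move=> /finite_nat_bounded[N NP]; exists N => // n Nn.
  apply/seteqP; split => // x Ux.
  have := NP n; rewrite ltnNge -/(is_true _) => /(_ _)/negP.
  by move=> F; case: F => //; exists x.
pose n0 := maxn N1.+1 N2.
pose D k := W k `\` W k.+1.
(* With W n0.+1 in place of U E, the neighborhoods of the ends still cover all
   but a compact set, and they miss D n0. *)
have finD : finite_set (carrier @` D n0).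
  pose U' E' := if `[< E' = E >] then W n0.+1 else U E'.
  have [E' eE'|L cL UL] := @ends_cover R G G_infinite G_connected U'.
    rewrite /U'; case: asboolP => [->|_]; last exact: U_nbhd.
    apply: (end_nbhd_basis eE EW (U_nbhd eE)).
    by have := Wle 0%N n0.+1 isT; rewrite {2}/W muln0.
  apply: sub_finite_set (finite_carriers cL); apply: image_subset.
  move=> x [Wx nWx]; apply: UL => -[E' eE']; rewrite /U'.
  case: asboolP => // ne Ux.
  have : (U E' `&` W n0) x by [].
  by rewrite (N2P n0)//= leq_maxr.
apply: contrapT => nR.
(* Each point of W n lies in a later difference, because the intersection of
   the basis is empty. *)
have far n : exists k x, [/\ (n <= k)%N, D k x & ~ range g x].
  have [x Wx nx] : exists2 x, W n x & ~ range g x.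
    apply: contrapT => h; apply: nR; exists n => x Wx.
    by apply: contrapT => nx; apply: h; exists x.
  apply: contrapT => h.
  have Wj j : W (n + j)%N x.
    elim: j => [|j IH]; first by rewrite addn0.
    rewrite addnS; apply: contrapT => nW; apply: h.
    by exists (n + j)%N, x; split => //; apply: leq_addr.
  have [N NP] := end_basis_avoids bW (@compact_set1 _ x).
  have : (W (n + N)%N `&` [set x]) x by split.
  by rewrite NP// leq_addl.
pose J := [set j | exists x, D (n0 + j)%N x /\ ~ range g x].
have /choice[f fP] : forall j, exists x,
    J j -> D (n0 + j)%N x /\ ~ range g x.
  move=> j; have [[x xP]|nJ] := pselect (J j); first by exists x.
  by have [x _] := graph_nonempty G_infinite; exists x.
pose q j := carrier (iter (p * j) g (f j)).
have fH j : J j -> forall i, (i < p * j)%N -> H (iter i g (f j)).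
  move=> /fP[[Wf _] _] i ij.
  have i_p : (i %/ p < j)%N by rewrite ltn_divLR// mulnC.
  rewrite {1}(divn_eq i p) addnC iterD mulnC.
  apply: (N1H (n0 + j - i %/ p)%N); last exact: ltn_pmod.
    apply: leq_trans (leq_maxl N1.+1 N2) _.
    by rewrite -addnBA; [exact: leq_addr|exact: ltnW].
  apply/(WS _ (n0 + j - i %/ p)%N); rewrite subnKC//.
  by apply: leq_trans (ltnW i_p) _; apply: leq_addl.
(* If two cells agree, f j is the image under an iterate of g of a point in the
   cell of f j', contrary to the choice of f j. *)
have qlt j j' : J j -> J j' -> (j < j')%N -> q j <> q j'.
  move=> Jj Jj' jj' qE.
  have : carrier (iter (p * j') g (f j')) (iter (p * j) g (f j)).
    by rewrite -/(q j') -qE; left.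
  move=> /(carrier_lift (fH _ Jj'))[y gy Hy].
  have [_] := fP _ Jj; apply.
  have -> : f j = iter (p * (j' - j)) g y.
    apply: (@iter_inj (p * j)); first exact: fH.
      move=> i ij; rewrite -iterD; apply: Hy.
      by rewrite -[X in (_ < p * X)%N](subnK (ltnW jj')) mulnDr addnC ltn_add2l.
    by rewrite -iterD -mulnDr subnKC// ltnW.
  have : (0 < p * (j' - j))%N by rewrite muln_gt0 p_gt0 subn_gt0.
  by case: (p * (j' - j))%N => // m _; exists (iter m g y).
have finJ : finite_set J.
  have qi : {in J &, injective q}.
    move=> j j' /set_mem Jj /set_mem Jj' qE.
    by have [/(qlt _ _ Jj Jj')|/(qlt _ _ Jj' Jj)|] := ltngtP j j'; rewrite ?qE.
  have <- := eq_finite_set (inj_card_eq qi).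
  apply: sub_finite_set finD => _ [j Jj <-].
  exists (iter (p * j) g (f j)) => //.
  have [[Wf nWf] _] := fP _ Jj; split.
    by apply/WS; rewrite addnC.
  by move=> /WS; rewrite addnS addnC.
have [N NP] := finite_nat_bounded finJ.
have [k [x [nk Dk nx]]] := far (n0 + N)%N.
have /NP : J (k - n0)%N.
  by exists x; rewrite subnKC//; apply: leq_trans nk; apply: leq_addr.
by rewrite ltnNge leq_subRL ?nk//; apply: leq_trans nk; apply: leq_addr.
Qed.

(** Near a repelling end this is repelling_range; a neighborhood of an
    attracting end is by definition mapped onto another one. *)
Lemma range_cocompact :
  (forall E, ends E -> attracting g p E (U E) \/ repelling g p E (U E)) ->
  in_compact (~` range g).
Proof.
move=> dyn.
have /choice[W WP] : forall E, exists W, ends E ->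
    end_nbhd E W /\ W `<=` range g.
  move=> E; have [eE|nE] := pselect (ends E); last by exists set0.
  have [att|rep] := dyn E eE.
    have [sub EV] := att; exists (iter (p * 1) g @` U E) => _; split.
      apply: (end_nbhd_basis (n := 1%N) eE EV (U_nbhd eE)).
      by rewrite muln1; exact: sub.1.
    move=> _ [x _ <-]; rewrite muln1 -(prednK p_gt0).
    by exists (iter p.-1 g x).
  have [n nR] := repelling_range eE rep; have [sub EV] := rep.
  exists (iter (p * n) g @^-1` U E) => _; split => //.
  apply: (end_nbhd_basis (n := n) eE EV (U_nbhd eE)).
  have := end_basis_le (end_basisW eE EV) (leq0n n).
  by rewrite muln0.
apply: in_compactS (ends_cover G_infinite G_connected (W := W) _).
  by move=> x nx [E eE Wx]; apply: nx; have [_ ] := WP E eE; apply.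
by move=> E eE; have [] := WP E eE.
Qed.

End Dynamics.

(** * The inverse near the ends *)

Section InverseNearEnds.
Context {R : realType} {G : graph R}.
Context (G_infinite : graph_infinite G) (G_connected : connected [set: G]).

(** The set Q of points whose preimage is a single point of H contains
    everything but the image of a compact set and the points outside the range.
    Its largest subgraph serves as A, because edges of H are mapped onto
    edges. *)
Lemma inverse_domain (g : G -> G) (H : set G) (k : G -> G) :
  graph_map g -> saturated H ->
  in_compact (~` H) -> in_compact (~` range g) ->
  {within g @` H, continuous k} -> (forall x, H x -> k (g x) = x) ->
  (forall e : edge G, cell e `<=` H ->
    exists e' : edge G, g @` cell e = cell e') ->
  exists A : set G,
    [/\ saturated A, in_compact (~` A) & {within A, continuous k}] /\
    [/\ forall a, A a -> g @^-1` [set a] = [set k a],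
        forall v, A v -> vertex v -> vertex (k v) &
        forall e : edge G, closed_edge e `<=` A ->
          exists e' : edge G, k @` cell e = cell e'].
Proof.
move=> [cg gv _] sH [C cC HC] rg ck kg gcell.
pose Q := [set x | exists2 y, H y & g @^-1` [set x] = [set y]].
have QC : in_compact (~` Q).
  apply: (@in_compactS _ _ (~` range g `|` g @` C)).
    move=> x nQ; have [[y _ yx]|nx] := pselect (range g x); [right|by left].
    apply: contrapT => nC; apply: nQ.
    have HP z : g z = x -> H z.
      by move=> zx; apply: contrapT => /HC Cz; apply: nC; exists z.
    exists y; first exact: HP.
    apply/seteqP; split => z /=; last by move=> ->.
    by move=> zx; rewrite -(kg z (HP _ zx)) zx -yx kg//; apply: HP.
  apply: in_compactU => //; exists (g @` C) => //.
  by apply: continuous_compact => //; apply: within_continuousW.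
pose A := largest_subgraph Q.
have AP a : A a -> [/\ H (k a), g (k a) = a & g @^-1` [set a] = [set k a]].
  move=> /largest_subgraph_sub[y Hy yP].
  have gy : g y = a by have : (g @^-1` [set a]) y by rewrite yP.
  have ka : k a = y by rewrite -gy; apply: kg.
  by rewrite ka.
have kcell e0 a e : A a -> cell e a -> cell e0 (k a) ->
    cell e0 `<=` H /\ g @` cell e0 = cell e.
  move=> Aa ea e0k; have [Hk gk _] := AP a Aa.
  have e0H : cell e0 `<=` H.
    by move=> z /cell_closed_edge; apply: (sH e0) e0k Hk _.
  have [e' ge0] := gcell _ e0H; split => //; rewrite ge0; congr cell.
  by apply: (@cell_inj _ _ _ _ a) => //; rewrite -ge0 -gk; exists (k a).
exists A; split; split.
- exact: saturated_largest_subgraph.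
- exact: in_compact_largest_subgraph.
- by apply: continuous_subspaceW ck => a /AP[? <- _]; exists (k a).
- by move=> a /AP[].
- move=> v Av vv; have [Hk gk _] := AP v Av.
  have [//|[e [s s01 ks]]] := graph_cover (k v).
  have ek : cell e (k v) by exists s.
  have eH : cell e `<=` H by move=> z /cell_closed_edge; apply: sH ek Hk _.
  have [e' ge] := gcell _ eH; have : cell e' v by rewrite -ge -gk; exists (k v).
  by move=> /cell_not_vertex.
- move=> e eA.
  pose a := charmap e (1 / 2); have ea : cell e a by apply: cell_midpoint.
  have Aa : A a by apply/eA/cell_closed_edge.
  have [Hk gk _] := AP a Aa.
  have [vk|[e0 [s s01 ks]]] := graph_cover (k a).
    have /cell_not_vertex := ea; case; rewrite -gk; apply: gv.
    by exists (k a).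
  have e0k : cell e0 (k a) by exists s.
  have [e0H ge0] := kcell e0 a e Aa ea e0k.
  exists e0; apply/seteqP; split => z.
    move=> [b eb <-]; have : (g @` cell e0) b by rewrite ge0.
    by move=> [y e0y <-]; rewrite kg//; apply: e0H.
  move=> e0z; exists (g z); first by rewrite -ge0; exists z.
  by rewrite kg//; apply: e0H.
Qed.

(** On A one has h = h g k, so the homotopy from h g to the identity, evaluated
    at the points k a, moves h to k over A; extending it to the whole graph
    changes the homotopy inverse h into one that restricts to k. *)
Lemma homotopy_inverse_extending (g k : G -> G) (A : set G) :
  saturated A -> {within A, continuous k} -> continuous g ->
  (forall a, A a -> g @^-1` [set a] = [set k a]) ->
  (forall v, A v -> vertex v -> vertex (k v)) ->
  (forall e : edge G, closed_edge e `<=` A ->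
    exists e' : edge G, k @` cell e = cell e') ->
  @homotopy_equivalence R G G g ->
  exists g' : G -> G, [/\ @homotopy_inverse R G G g g', graph_map g' &
    forall a, A a -> g' a = k a].
Proof.
move=> sA ck cg gk kv kcell [_ [h hP]].
have gkK a : A a -> g (k a) = a.
  by move=> /gk ga; have : (g @^-1` [set a]) (k a) by rewrite ga.
have [ch [F [cF F0 F1]] _] := hP.
have on_edge := on_closed_edge G_infinite G_connected.
have [|||g' [hg' g'k g'v g'e]] := @cellular_extension R G on_edge A h k
    (fun z => F (k z.1, z.2)) sA ch.
- apply: (@within_continuous_comp _ _ _ _ _
    (fun z : G * R => (k z.1, z.2)) _ _ cF) => [|[a t] [/= _ t01]]; last by split.
  apply: within_continuous_pair; last exact: within_continuous_snd.
  apply: (within_continuous_comp _ ck) => [|z []//].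
  exact: within_continuous_fst.
- by move=> a Aa /=; rewrite F0 F1 /= gkK.
- by [].
have cg' := homotopic_continuous hg'.
exists g'; split => //; first exact: homotopy_inverse_homotopic hg'.
split => //; first by move=> _ [v vv <-]; apply: g'v.
move=> e; have [eA|] := pselect (closed_edge e `<=` A); last exact: g'e.
have eA' s : s \in `]0, 1[ -> A (charmap e s).
  by move=> s01; apply/eA/cell_closed_edge; exists s.
have [e' ke] := kcell e eA.
apply: (@edge_path_homeomorphism _ _ _ e').
- apply: (within_continuous_comp (B := setT)) => //.
    exact: charmap_continuous.
  exact: within_continuousW.
- move=> s s01 /=; rewrite g'k; last exact: eA'.
  by rewrite -ke; exists (charmap e s) => //; exists s.
- move=> s t s01 t01 /=; rewrite !g'k; [|exact: eA'|exact: eA'].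
  move=> /(congr1 g); rewrite !gkK; [|exact: eA'|exact: eA'].
  by move=> /charmap_inj[].
- rewrite -ke => _ [_ [s s01 <-] <-]; exists s => //=.
  by rewrite g'k//; apply: eA'.
Qed.

End InverseNearEnds.

Section InverseDynamics.
Context {R : realType} {G : graph R}.
Context (g g' : G -> G) (g_map : graph_map g) (g'_map : graph_map g').
Context (A C : set G) (C_compact : compact C) (AC : ~` A `<=` C).
Context (g_g' : forall a, A a -> g @^-1` [set a] = [set g' a]).
Context (p : nat) (p_gt0 : (0 < p)%N).
Implicit Types (X U K : set G) (E : set (nat -> set G)) (V : nat -> set G).

Lemma avoids_sub X : X `&` C = set0 -> X `<=` A.
Proof.
move=> XC x Xx; apply: contrapT => /AC Cx.
by have : (X `&` C) x by []; rewrite XC.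
Qed.

Lemma inverseKr a : A a -> g (g' a) = a.
Proof. by move=> /g_g' ga; have : (g @^-1` [set a]) (g' a) by rewrite ga. Qed.

Lemma inverseKl x : A (g x) -> g' (g x) = x.
Proof.
move=> /g_g' gx; have : (g @^-1` [set g x]) x by [].
by rewrite gx.
Qed.

Lemma inverse_image X : X `&` C = set0 -> g' @` X = g @^-1` X.
Proof.
move=> /avoids_sub XA; apply/seteqP; split => y.
  by move=> [x Xx <-] /=; rewrite inverseKr//; apply: XA.
by move=> Xgy; exists (g y) => //; rewrite inverseKl//; apply: XA.
Qed.

(** A point of X may have preimages under g' in C, where g' is not the inverse
    of g; this is why X has to avoid the image of C. *)
Lemma inverse_preimage X : X `&` g' @` C = set0 -> g @` X `&` C = set0 ->
  g' @^-1` X = g @` X.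
Proof.
move=> XC gXC; have gXA := avoids_sub gXC; apply/seteqP; split => y.
  move=> Xy; have Ay : A y.
    apply: contrapT => /AC Cy.
    have : (X `&` g' @` C) (g' y) by split => //; exists y.
    by rewrite XC.
  by exists (g' y) => //; rewrite inverseKr.
by move=> [x Xx <-] /=; rewrite inverseKl//; apply: gXA; exists x.
Qed.

Lemma iter_image n X : (forall i, (i < n)%N -> iter i g @^-1` X `&` C = set0) ->
  iter n g' @` X = iter n g @^-1` X.
Proof.
elim: n => [|n IH] XC; first by rewrite image_id.
rewrite (_ : iter n.+1 g' @` X = g' @` (iter n g' @` X)); last by rewrite -image_comp.
rewrite IH => [|i ni]; last by apply: XC; apply: ltnW.
rewrite inverse_image; last exact: XC.
by apply/seteqP; split => x /=; rewrite -iterSr.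
Qed.

Lemma iter_preimage n X :
  (forall i, (i <= n)%N -> iter i g @` X `&` (C `|` g' @` C) = set0) ->
  iter n g' @^-1` X = iter n g @` X.
Proof.
move=> XC.
have {}XC i : (i <= n)%N ->
    iter i g @` X `&` C = set0 /\ iter i g @` X `&` g' @` C = set0.
  by move=> /XC; rewrite setIUr setU_eq0.
elim: n XC => [|n IH] XC.
  by apply/seteqP; split => [x Xx|_ [x Xx <-]]//; exists x.
have imS : iter n.+1 g @` X = g @` (iter n g @` X) by rewrite -image_comp.
rewrite (_ : iter n.+1 g' @^-1` X = g' @^-1` (iter n g' @^-1` X)); last first.
  by apply/seteqP; split => x /=; rewrite -iterSr.
rewrite IH => [|i ni]; last by apply: XC; apply: leqW.
rewrite inverse_preimage ?imS//; first by have [] := XC n (leqnSn n).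
by rewrite -imS; have [] := XC n.+1 (leqnn _).
Qed.

(** If one step were stationary, so would be all later ones, but the basis
    eventually avoids each point. *)
Lemma end_basis_strict V (f : set G -> set G) : end_basis V ->
  (forall n, V n.+1 = f (V n)) -> (forall X Y, X `<=` Y -> f X `<=` f Y) ->
  forall n, ~ V n `<=` V n.+1.
Proof.
move=> bV Vf fm n nn.
have step m : V (n + m)%N `<=` V (n + m).+1.
  elim: m => [|m IH]; first by rewrite addn0.
  by rewrite addnS Vf [X in _ `<=` X]Vf; apply: fm.
have [x Vx] := end_basis_nonempty n bV.
have Vm m : V (n + m)%N x.
  by elim: m => [|m /step]; rewrite ?addn0// addnS.
have [N NP] := end_basis_avoids bV (@compact_set1 _ x).
have : (V (n + N)%N `&` [set x]) x by split.
by rewrite NP// leq_addl.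
Qed.

(** The definitions of attracting and repelling control only the iterates whose
    order is a multiple of p. The others are reduced to these by following the
    orbits of K for at most p steps. *)
Lemma attracting_avoids E U K : ends E -> attracting g p E U -> compact K ->
  exists m, forall j, (p * m <= j)%N -> iter j g @` U `&` K = set0.
Proof.
move=> eE [_ EV] cK; have [K' cK' KK'] := compact_orbit g_map p cK.
have [N NP] := end_basis_avoids (end_basisW eE EV) cK'.
exists N => j Nj; apply/seteqP; split => // _ [[x Ux <-] Kx].
have jp : (j <= p * (j %/ p).+1)%N by rewrite mulnC ltnW// ltn_ceil.
pose i := (p * (j %/ p).+1 - j)%N.
have ip : (i <= p)%N.
  rewrite leq_subLR mulnS addnC leq_add2r mulnC; exact: leq_divM.
have jN : (N <= (j %/ p).+1)%N by rewrite leqW// leq_divRL// mulnC.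
suff : ([set iter (p * (j %/ p).+1) g x | x in U] `&` K') (iter i g (iter j g x)).
  by rewrite NP.
split; last exact: KK'.
by exists x => //; rewrite -iterD subnK.
Qed.

Lemma repelling_avoids E U K : ends E -> repelling g p E U -> compact K ->
  exists m, forall j, (p * m <= j)%N -> iter j g @^-1` U `&` K = set0.
Proof.
move=> eE [_ EV] cK; have [K' cK' KK'] := compact_orbit g_map p cK.
have [N NP] := end_basis_avoids (end_basisW eE EV) cK'.
exists N => j Nj; apply/seteqP; split => // x [Ux Kx].
have jN : (N <= j %/ p)%N by rewrite leq_divRL// mulnC.
suff : (iter (p * (j %/ p)) g @^-1` U `&` K') (iter (j %% p) g x).
  by rewrite NP.
split; first by rewrite /= -iterD mulnC -divn_eq.
by apply: KK' => //; apply/ltnW/ltn_pmod.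
Qed.

Lemma end_nbhd_tail E V m : ends E -> E V -> end_nbhd E (V 0%N) ->
  end_nbhd E (V m).
Proof.
move=> eE EV nV; apply: (end_nbhd_basis eE EV nV).
exact: end_basis_le (end_basisW eE EV) _ _ (leq0n m).
Qed.

(** Far enough out, images under g' are preimages under g and conversely, so
    the same neighborhoods, after a shift, show that attracting ends of g are
    repelling for g' and conversely. *)
Lemma inverse_dynamics E U : ends E -> end_nbhd E U ->
  attracting g p E U \/ repelling g p E U ->
  exists U', [/\ end_nbhd E U', U' `<=` A &
    attracting g' p E U' \/ repelling g' p E U'].
Proof.
move=> eE nU [att|rep].
  have cK : compact (C `|` g' @` C).
    apply: compactU => //; apply: continuous_compact => //.
    by apply: within_continuousW; have [] := g'_map.
  have [m mP] := attracting_avoids eE att cK.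
  have [sub EV] := att; set V := fun n => _ in EV.
  have bV := end_basisW eE EV.
  have VE n i : iter i g @` V n = iter (i + p * n) g @` U.
    rewrite /V image_comp; apply/seteqP.
    by split => _ [x Ux <-]; exists x => //=; rewrite iterD.
  have preV n : iter n g' @^-1` V m = iter n g @` V m.
    by apply: iter_preimage => i _; rewrite VE; apply: mP; apply: leq_addl.
  have VS n : V n.+1 = iter p g @` V n by rewrite VE /V mulnS.
  exists (V m); split.
  - apply: end_nbhd_tail => //; rewrite (_ : V 0%N = U)//.
    by rewrite /V muln0; apply/seteqP; split => [_ [x Ux <-]|x Ux]//; exists x.
  - apply: avoids_sub; have := mP (p * m)%N (leqnn _).
    by rewrite setIUr setU_eq0 => -[].
  - right; split; rewrite ?preV -?VS.
      split; first by apply: (end_basis_le bV).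
      apply: (end_basis_strict (f := fun X => iter p g @` X) bV VS) => X Y XY.
      exact: image_subset.
    rewrite (_ : (fun n => _) = fun n => V (m + n)%N); first exact: end_shift.
    by apply/funext => n; rewrite preV VE /V -mulnDr addnC.
have [m mP] := repelling_avoids eE rep C_compact.
have [sub EV] := rep; set V := fun n => _ in EV.
have bV := end_basisW eE EV.
have VE n i : iter i g @^-1` V n = iter (i + p * n) g @^-1` U.
  by rewrite /V addnC; apply/seteqP; split => x /=; rewrite iterD.
have imV n : iter n g' @` V m = iter n g @^-1` V m.
  by apply: iter_image => i _; rewrite VE; apply: mP; apply: leq_addl.
have VS n : V n.+1 = iter p g @^-1` V n by rewrite VE /V mulnS.
exists (V m); split.
- by apply: end_nbhd_tail => //; rewrite /V muln0.
- by apply: avoids_sub; apply: mP.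
- left; split; rewrite ?imV -?VS.
    split; first by apply: (end_basis_le bV).
    apply: (end_basis_strict (f := fun X => iter p g @^-1` X) bV VS) => X Y XY.
    exact: preimage_subset.
  rewrite (_ : (fun n => _) = fun n => V (m + n)%N); first exact: end_shift.
  by apply/funext => n; rewrite imV VE /V -mulnDr addnC.
Qed.

End InverseDynamics.

Theorem theorem2 (R : realType) (G : graph R)
    (G_infinite : graph_infinite G)
    (G_connected : connected [set: G])
    (G_ends : finite_set (@ends R G))
    (g : G -> G)
    (g_endperiodic : end_periodic g)
    (g_equiv : @homotopy_equivalence R G G g) :
  exists g' : G -> G,
    [/\ @homotopy_inverse R G G g g',
        end_periodic g' &
        forall E, @ends R G E ->
          exists2 W, end_nbhd E W & restricts_to_inverse W g g'].
Proof.
have [g_map [U [U_nbhd [_ [k ck kg]] g_cell [p p_gt0 dyn]]]] := g_endperiodic.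
set H := largest_subgraph _ in ck kg g_cell.
have [cg _ _] := g_map.
have g_inj x y : H x -> H y -> g x = g y -> x = y.
  by move=> Hx Hy gxy; rewrite -(kg x Hx) gxy kg.
have HC : in_compact (~` H) by apply: embedded_part_cocompact.
have rC : in_compact (~` range g) by apply: range_cocompact dyn.
have [A [[sA [C cC AC] ckA] [gk kv kcell]]] :=
  inverse_domain g_map (@saturated_largest_subgraph _ _ _) HC rC ck kg g_cell.
have [g' [g'_inv g'_map g'k]] :=
  homotopy_inverse_extending G_infinite G_connected sA ckA cg gk kv kcell g_equiv.
have g_g' a : A a -> g @^-1` [set a] = [set g' a] by move=> Aa; rewrite g'k// gk.
have g_g'K a : A a -> g (g' a) = a.
  by move=> Aa; have : (g @^-1` [set a]) (g' a) by rewrite g_g'.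
have /choice[U' U'P] : forall E, exists U', ends E ->
    [/\ end_nbhd E U', U' `<=` A & attracting g' p E U' \/ repelling g' p E U'].
  move=> E; have [eE|nE] := pselect (ends E); last by exists set0.
  have [U' ?] := inverse_dynamics g_map g'_map cC AC g_g' p_gt0 eE
    (U_nbhd E eE) (dyn E eE).
  by exists U'.
have H'A : largest_subgraph (\bigcup_(E in @ends R G) U' E) `<=` A.
  by move=> x /largest_subgraph_sub[E eE Ux]; have [_ + _] := U'P E eE; apply.
exists g'; split => //.
- split => //; exists U'; split.
  + by move=> E eE; have [] := U'P E eE.
  + split; first by apply: within_continuousW; have [] := g'_map.
    exists g; first exact: within_continuousW.
    by move=> x /H'A; apply: g_g'K.
  + move=> e eH; have eA : closed_edge e `<=` A.
      exact: sA (cell_midpoint e) (H'A _ (eH _ (cell_midpoint e))).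
    have [e' ke] := kcell e eA; exists e'; rewrite -ke; apply: eq_imagel => x ex.
    by apply/g'k/eA/cell_closed_edge.
  + by exists p => // E eE; have [] := U'P E eE.
- move=> E eE; have [nU' U'A _] := U'P E eE.
  by exists (U' E) => // x /U'A; apply: g_g'.
Qed.
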